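(* Let $n\ge1$ and $K\in\mathcal{M}_n$. Let $|||\cdot|||_!$ be a symmetric anti-norm which satisfies the Hölder inequality $$|||\,|ST|^r\,|||_!^{\frac1r}\le |||\,|S|^{r_1}\,|||_!^{\frac1{r_1}}\cdot|||\,|T|^{r_2}\,|||_!^{\frac1{r_2}}$$ for all $S,T\in\mathcal{P}_n$ and all $r,r_1,r_2>0$ with $\frac1r=\frac1{r_1}+\frac1{r_2}$. Then for $0\le p,q\le1$ and $0<s\le \frac{1}{p+q}$ (read as $s>0$ if $p=q=0$), the map $$(A,B)\mapsto \left|\left|\left|\left(B^{\frac q2}K^*A^pKB^{\frac q2}\right)^s\right|\right|\right|_!$$ is jointly concave on $\mathcal{P}_n\times\mathcal{P}_n$.
   Context: $\mathcal{M}_n$ is the set of $n\times n$ (complex) matrices and $\mathcal{P}_n$ the set of $n\times n$ positive definite matrices. Powers of positive (semi)definite matrices are taken by functional calculus, and $|X|=(X^*X)^{1/2}$. A symmetric anti-norm $|||\cdot|||_!$ on $\mathcal{P}_n$ is a non-negative continuous function on $\mathcal{P}_n$ that is positively homogeneous, unitarily invariant ($|||UAU^*|||_!=|||A|||_!$ for unitary $U$), and superadditive: $|||A+B|||_!\ge|||A|||_!+|||B|||_!$ for all $A,B\in\mathcal{P}_n$. At a positive semidefinite (singular) matrix $X$ its value is defined by continuity, $|||X|||_!=\lim_{\varepsilon\downarrow0}|||X+\varepsilon I|||_!$. *)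

(* Defs.v *)
(* Complex scalars are R[i] for R : realType. *)
From mathcomp Require Import all_boot all_order all_algebra.
From mathcomp Require Import spectral sesquilinear.
From mathcomp Require Import all_classical all_reals all_analysis.
From mathcomp Require Import complex.

Set Implicit Arguments.
Unset Strict Implicit.
Unset Printing Implicit Defensive.

Import Order.TTheory GRing.Theory Num.Theory.
Import numFieldNormedType.Exports.

Open Scope classical_set_scope.
Open Scope complex_scope.
Open Scope sesquilinear_scope.
Open Scope ring_scope.

Section Defs.
Variables (R : realType) (n : nat).
Local Notation C := R[i].

(* The order of R[i] is partial: 0 < z forces z to be real. *)
Definition posdef : set 'M[C]_n :=
  [set A | A \is hermsymmx /\
           forall x : 'cV[C]_n, x != 0 -> 0 < (x ^t* *m A *m x) 0 0].

(* Functional calculus for a Hermitian A = U^* diag(a) U; the eigenvalues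
   a_i are real, hence the use of the real part.  The result does not depend
   on the diagonalization chosen by spectralmx and spectral_diag. *)
Definition mxfun (f : R -> R) (A : 'M[C]_n) : 'M[C]_n :=
  invmx (spectralmx A)
    *m diag_mx (map_mx (fun z : C => (f (complex.Re z))%:C) (spectral_diag A))
    *m spectralmx A.

(* For A positive semidefinite; 0 `^ s = 0 when s != 0, and x `^ 0 = 1. *)
Definition mxpow (A : 'M[C]_n) (s : R) : 'M[C]_n := mxfun (fun x => x `^ s) A.

Definition mxabs (X : 'M[C]_n) : 'M[C]_n := mxpow (X ^t* *m X) 2^-1.

(* N is only constrained on posdef; its values elsewhere are junk.
   The alias C^o carries the standard topology of the complex numbers. *)
Record symmetric_antinorm (N : 'M[C]_n -> R) : Prop := SymmetricAntinorm {
  antinorm_ge0 : forall A, posdef A -> 0 <= N A ;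
  antinorm_continuous :
    {within (posdef : set 'M[C^o]_n), continuous (N : 'M[C^o]_n -> R)} ;
  antinorm_homogeneous :
    forall (t : R) A, 0 < t -> posdef A -> N (t%:C *: A) = t * N A ;
  antinorm_unitary :
    forall U A, U \is unitarymx -> posdef A -> N (U *m A *m U ^t*) = N A ;
  antinorm_superadditive :
    forall A B, posdef A -> posdef B -> N A + N B <= N (A + B) }.

(* Extension by continuity to positive semidefinite X. The limit exists
   because an anti-norm is nonnegative and, by superadditivity, monotone;
   it equals N X when X is positive definite. *)
Definition antinorm_ext (N : 'M[C]_n -> R) (X : 'M[C]_n) : R :=
  lim (N (X + (e%:C)%:M) @[e --> 0^'+]).

Definition antinorm_hoelder (N : 'M[C]_n -> R) : Prop :=
  forall S T : 'M[C]_n, posdef S -> posdef T ->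
  forall r r1 r2 : R, 0 < r -> 0 < r1 -> 0 < r2 -> r^-1 = r1^-1 + r2^-1 ->
    N (mxpow (mxabs (S *m T)) r) `^ r^-1 <=
    N (mxpow (mxabs S) r1) `^ r1^-1 * N (mxpow (mxabs T) r2) `^ r2^-1.

Definition jointly_concave (D : set 'M[C]_n) (f : 'M[C]_n -> 'M[C]_n -> R) :=
  forall A1 A2 B1 B2, D A1 -> D A2 -> D B1 -> D B2 ->
  forall t : R, 0 <= t <= 1 ->
    t * f A1 B1 + (1 - t) * f A2 B2 <=
    f (t%:C *: A1 + (1 - t)%:C *: A2) (t%:C *: B1 + (1 - t)%:C *: B2).

End Defs.

Arguments posdef {R n}.

(* Main.v *)
(** Hoelder's and Young's inequalities bound the functional at every [(A, B)] by
    a combination of two terms depending on [A] or on [B] only, with equality for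
    a suitable auxiliary matrix; so it suffices to prove that
    [A |-> N ((L^* A^p L)^s)] is concave for every [L] when [p s <= 1].

    As a function of the sorted eigenvalues, an anti-norm is concave, symmetric
    and monotone, hence (Hardy, Littlewood, Polya) monotone with respect to the
    sums of the [k] smallest eigenvalues.  These sums are handled by compressing
    to the first [k] eigenvectors of the matrix at the convex combination and
    interlacing, which leaves Epstein's trace inequality.  The latter follows
    for [s <= 1] from Jensen's inequality and for [s > 1] from Lieb's concavity
    of [(A, B) |-> tr (L^* A^p L B^c)], [p + c <= 1], by the duality of Carlen
    and Lieb.

    In the eigenbases of [A] and [B], Lieb's function is a quadratic form in [L]
    with weights [u^p v^c].  The weights giving a jointly concave form include
    [1], [u] and [v] and are closed under sums and under parallel sums (which
    are infimal convolutions), hence under geometric means (limits of the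
    arithmetic-harmonic iteration), hence contain all [u^p v^c]. *)

From HB Require Import structures.
Require Import Defs.
From mathcomp Require Import all_boot all_order all_algebra.
From mathcomp Require Import spectral sesquilinear.
From mathcomp Require Import all_classical all_reals all_analysis.
From mathcomp Require Import complex ring lra perm.

Set Implicit Arguments.
Unset Strict Implicit.
Unset Printing Implicit Defensive.

Import Order.TTheory GRing.Theory Num.Theory.
Import numFieldNormedType.Exports.

Open Scope classical_set_scope.
Open Scope complex_scope.
Open Scope sesquilinear_scope.
Open Scope ring_scope.

(** * Scalar means and jointly concave weights *)

Section ScalarMeans.
Variable R : realType.
Implicit Types x y a b s t : R.

(** Young's inequality for the conjugate exponents [1/s] and [1/(1 - s)], applied to [x^s] and
    [y^(1 - s)]. *)
Lemma young x y s : 0 <= x -> 0 <= y -> 0 < s < 1 ->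
  x `^ s * y `^ (1 - s) <= s * x + (1 - s) * y.
Proof.
move=> x0 y0 /andP[s0 s1].
have s1' : 0 < 1 - s by lra.
have := @conjugate_powR R (x `^ s) (y `^ (1 - s)) s^-1 (1 - s)^-1.
rewrite !invrK -!powRrM !mulfV ?gt_eqF // !powRr1 //.
rewrite [s * x]mulrC [(1 - s) * y]mulrC.
by apply; rewrite ?powR_ge0 ?invr_gt0 //; ring.
Qed.

Lemma ge0_le_add_geom (x y c : R) :
  (forall k, x <= y + c / 2 ^+ k) -> x <= y.
Proof.
move=> H.
have cv : (y + c / 2 ^+ k) @[k --> \oo] --> y.
  rewrite -[X in _ --> X]addr0; apply: cvgD; first exact: cvg_cst.
  rewrite -[X in _ --> X](mulr0 c); apply: cvgMr.
  have := @cvg_geometric R 1 2^-1 _.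
  rewrite /geometric /=; under eq_fun do rewrite mul1r exprVn.
  by apply; rewrite ger0_norm; lra.
rewrite -(cvg_lim _ cv) //; apply: limr_ge; first by apply/cvg_ex; exists y.
by apply: nearW.
Qed.

(** One step of the arithmetic-harmonic iteration. If both entries vanish, the convention [0^-1 = 0]
    makes the harmonic mean [0]. *)
Definition am_hm (xy : R * R) :=
  ((xy.1 + xy.2) / 2, 2 * (xy.1 * xy.2 / (xy.1 + xy.2))).

(** The gap after a step is [(u - v)^2 / (2 (u + v))], which is nonnegative and at most half of
    [u - v] when [0 <= v <= u]. The two entries are ordered only after one step, hence the index
    [k.+1]. *)
Lemma am_hm_iter x y k : 0 <= x -> 0 <= y ->
  let uv := iter k.+1 am_hm (x, y) in
  [/\ uv.1 * uv.2 = x * y, 0 <= uv.2, uv.2 <= uv.1 &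
      uv.1 - uv.2 <= (x + y) / 2 ^+ k].
Proof.
move=> x0 y0 uv; rewrite {}/uv.
have step (u v : R) : 0 <= u -> 0 <= v -> let uv := am_hm (u, v) in
  [/\ uv.1 * uv.2 = u * v, 0 <= uv.1, 0 <= uv.2, uv.2 <= uv.1 &
      (v <= u -> uv.1 - uv.2 <= (u - v) / 2)].
  move=> u0 v0 /=.
  have [uv0|uv0] := eqVneq (u + v) 0.
    have -> : u = 0 by lra.
    have -> : v = 0 by lra.
    by split; rewrite ?(mul0r,mulr0,addr0,subr0,lexx).
  have uvp : 0 < u + v by rewrite lt0r uv0 addr_ge0.
  have D : (u + v) / 2 - 2 * (u * v / (u + v)) = (u - v) ^+ 2 / (2 * (u + v)).
    by field.
  split.
  - by field.
  - by rewrite divr_ge0 // addr_ge0.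
  - by rewrite mulr_ge0 // divr_ge0 ?mulr_ge0 // ltW.
  - rewrite -subr_ge0 D divr_ge0 ?sqr_ge0 //; lra.
  - move=> vu; rewrite D ler_pdivrMr ?mulr_gt0 //.
    have -> : (u - v) / 2 * (2 * (u + v)) = (u - v) * (u + v) by field.
    by rewrite expr2 ler_wpM2l; lra.
elim: k => [|k]; last first.
  rewrite (iterS k.+1); move: (iter k.+1 _ _) => [u v] [/= IH1 IH2 IH3 IH4].
  have [H1 H2 H3 H4 /(_ IH3) H5] := step _ _ (le_trans IH2 IH3) IH2.
  split => //; first by rewrite H1.
  by apply: le_trans H5 _; rewrite exprSr invfM mulrA ler_wpM2r.
have [E1 E2 E3 E4 _] := step _ _ x0 y0; split => //.
by rewrite expr0 divr1; move: E3 => /=; lra.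
Qed.

Lemma am_hm_sqrt x y k : 0 <= x -> 0 <= y ->
  Num.sqrt (x * y) <= (iter k.+1 am_hm (x, y)).1 <=
  Num.sqrt (x * y) + (x + y) / 2 ^+ k.
Proof.
move=> x0 y0; have [H1 H2 H3 H4] := am_hm_iter k x0 y0.
set u := (iter _ _ _).1 in H1 H3 H4 *; set v := (iter _ _ _).2 in H1 H2 H3 H4.
have u0 : 0 <= u by exact: le_trans H3.
have vs : v <= Num.sqrt (x * y).
  by rewrite -[leLHS](ger0_norm H2) -sqrtr_sqr ler_wsqrtr // expr2 -H1 ler_wpM2r.
have su : Num.sqrt (x * y) <= u.
  by rewrite -[leRHS](ger0_norm u0) -sqrtr_sqr ler_wsqrtr // expr2 -H1 ler_wpM2l.
by rewrite su /=; lra.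
Qed.

(** Zero bases are treated apart: [0^r] is [0] for [r > 0] but jumps to [1] at [r = 0], so the
    exponent has to stay away from [0] and [1]. *)
Lemma continuous_geometric_mean x y s : 0 <= x -> 0 <= y -> 0 < s < 1 ->
  {for s, continuous (fun r => x `^ r * y `^ (1 - r))}.
Proof.
move=> x0 y0 /andP[s0 s1].
have N0 : \forall r \near s, 0 < r by exact: lt_nbhsr.
rewrite /prop_for /continuous_at.
have N1 : \forall r \near s, r < 1 by exact: lt_nbhsl.
have [x_0|xn0] := eqVneq x 0.
  rewrite x_0 [0 `^ s]powR0 ?gt_eqF // mul0r.
  apply: cvg_near_cst; near=> r; rewrite powR0 ?mul0r //.
  by rewrite gt_eqF //; near: r.
have [y_0|yn0] := eqVneq y 0.
  rewrite y_0 [0 `^ (1 - s)]powR0 ?mulr0; last by rewrite gt_eqF //; lra.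
  apply: cvg_near_cst; near=> r; rewrite [0 `^ _]powR0 ?mulr0 //.
  by rewrite gt_eqF // subr_gt0; near: r.
rewrite /powR (negbTE xn0) (negbTE yn0).
apply: cvgM; (apply: continuous_cvg; first exact: continuous_expR);
  apply: cvgMl; first exact: cvg_id.
by apply: cvgB; [exact: cvg_cst|exact: cvg_id].
Unshelve. all: by end_near.
Qed.

End ScalarMeans.

(** * Weights whose quadratic form is jointly concave, and their closure properties *)

Section ConcaveWeights.
Variables (R : realType) (I : finType) (E : zmodType).
Local Notation C := R[i].

Definition sqmod (z : C) : R := complex.Re z ^+ 2 + complex.Im z ^+ 2.

Lemma sqmod_ge0 z : 0 <= sqmod z.
Proof. by rewrite addr_ge0 ?sqr_ge0. Qed.

Lemma sqmodM z w : sqmod (z * w) = sqmod z * sqmod w.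
Proof. by case: z w => [a b] [c d]; rewrite /sqmod /=; ring. Qed.

Lemma sqmod_real (r : R) : sqmod r%:C = r ^+ 2.
Proof. by rewrite /sqmod /= expr0n addr0. Qed.

(** Multiplied by [g + h], the defect of the inequality is the squared modulus of [g y - h z]. *)
Lemma sqmod_par (g h : R) (y z : C) : 0 <= g -> 0 <= h ->
  g * h / (g + h) * sqmod (y + z) <= g * sqmod y + h * sqmod z.
Proof.
move=> g0 h0; have [gh0|ghn0] := eqVneq (g + h) 0.
  by rewrite gh0 invr0 mulr0 mul0r addr_ge0 // mulr_ge0 // sqmod_ge0.
have ghp : 0 < g + h by rewrite lt0r ghn0 addr_ge0.
rewrite mulrAC ler_pdivrMr //; case: y z => [a b] [c d]; rewrite /sqmod /=.
rewrite -subr_ge0.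
have -> : (g * (a ^+ 2 + b ^+ 2) + h * (c ^+ 2 + d ^+ 2)) * (g + h) -
  g * h * ((a + c) ^+ 2 + (b + d) ^+ 2) =
  (g * a - h * c) ^+ 2 + (g * b - h * d) ^+ 2 by ring.
by rewrite addr_ge0 ?sqr_ge0.
Qed.

(** The equality case of [sqmod_par]: this splitting [x = y + z] satisfies [g y = h z]. *)
Lemma sqmod_par_split (g h : R) (x : C) : 0 <= g -> 0 <= h ->
  g * sqmod ((h / (g + h))%:C * x) + h * sqmod (x - (h / (g + h))%:C * x) =
  g * h / (g + h) * sqmod x.
Proof.
move=> g0 h0; have [gh0|ghn0] := eqVneq (g + h) 0.
  have -> : g = 0 by lra.
  have -> : h = 0 by lra.
  by rewrite !mul0r addr0.
have -> : x - (h / (g + h))%:C * x = (g / (g + h))%:C * x.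
  rewrite -{1}[x]mul1r -mulrBl -(rmorph1 (real_complex R)) -rmorphB /=.
  by congr (_%:C * _); field.
by rewrite !sqmodM !sqmod_real; field.
Qed.

Variables (phi0 phi1 phi2 : E -> I -> C).
Variables (a0 b0 a1 b1 a2 b2 : I -> R) (t : R).
Hypotheses (phi0B : forall x y i, phi0 (x - y) i = phi0 x i - phi0 y i)
  (phi0_surj : forall c : I -> C, exists x, forall i, phi0 x i = c i).
Hypotheses (phi1D : forall x y i, phi1 (x + y) i = phi1 x i + phi1 y i)
  (phi2D : forall x y i, phi2 (x + y) i = phi2 x i + phi2 y i).
Hypotheses (a0_ge0 : forall i, 0 <= a0 i) (b0_ge0 : forall i, 0 <= b0 i)
  (a1_ge0 : forall i, 0 <= a1 i) (b1_ge0 : forall i, 0 <= b1 i)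
  (a2_ge0 : forall i, 0 <= a2 i) (b2_ge0 : forall i, 0 <= b2 i).
Hypothesis t01 : 0 <= t <= 1.

Let t_ge0 : 0 <= t. Proof. by case/andP: t01. Qed.
Let t'_ge0 : 0 <= 1 - t. Proof. by rewrite subr_ge0; case/andP: t01. Qed.

(** In the application [E] consists of matrices, [phi] gives the entries in a pair of eigenbases,
    and [a], [b] are the eigenvalues belonging to the row and to the column. *)
Definition wsum (phi : E -> I -> C) (a b : I -> R) (g : R -> R -> R) x :=
  \sum_i g (a i) (b i) * sqmod (phi x i).

(* Index [0] is the convex combination of the data with indices [1] and [2]. *)
Definition conc_weight (g : R -> R -> R) := forall x,
  t * wsum phi1 a1 b1 g x + (1 - t) * wsum phi2 a2 b2 g x <=
  wsum phi0 a0 b0 g x.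

Definition weight_ge0 (g : R -> R -> R) :=
  forall x y, 0 <= x -> 0 <= y -> 0 <= g x y.

Lemma ler_wsum phi a b g h x :
  (forall i, 0 <= a i) -> (forall i, 0 <= b i) ->
  (forall u v, 0 <= u -> 0 <= v -> g u v <= h u v) ->
  wsum phi a b g x <= wsum phi a b h x.
Proof.
by move=> ha hb gh; apply: ler_sum => i _; rewrite ler_wpM2r ?sqmod_ge0 ?gh.
Qed.

Lemma wsumD phi a b g h x :
  wsum phi a b (fun u v => g u v + h u v) x =
  wsum phi a b g x + wsum phi a b h x.
Proof. by rewrite -big_split /=; apply: eq_bigr => i _; rewrite mulrDl. Qed.

Lemma wsumZ phi a b c g x :
  wsum phi a b (fun u v => c * g u v) x = c * wsum phi a b g x.
Proof. by rewrite mulr_sumr; apply: eq_bigr => i _; rewrite mulrA. Qed.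

Lemma eq_conc_weight g h : (forall u v, 0 <= u -> 0 <= v -> g u v = h u v) ->
  conc_weight g -> conc_weight h.
Proof.
move=> gh H x; move: (H x).
have eqw phi a b : (forall i, 0 <= a i) -> (forall i, 0 <= b i) ->
    wsum phi a b g x = wsum phi a b h x.
  by move=> ha hb; apply: eq_bigr => i _; rewrite gh.
by rewrite !eqw.
Qed.

Lemma conc_weightD g h : conc_weight g -> conc_weight h ->
  conc_weight (fun u v => g u v + h u v).
Proof. by move=> Hg Hh x; rewrite !wsumD; move: (Hg x) (Hh x); lra. Qed.

Lemma conc_weightZ c g : 0 <= c -> conc_weight g ->
  conc_weight (fun u v => c * g u v).
Proof.
move=> c0 Hg x; rewrite !wsumZ; have := ler_wpM2l c0 (Hg x); lra.
Qed.

(* The parallel sum is the infimal convolution of the two quadratic forms. *)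
Lemma conc_weight_par g h : weight_ge0 g -> weight_ge0 h ->
  conc_weight g -> conc_weight h ->
  conc_weight (fun u v => g u v * h u v / (g u v + h u v)).
Proof.
move=> g0 h0 Hg Hh x; set p := fun u v => _.
(* The optimal splitting is chosen in the coordinates with index [0], where it gives equality. The
   same [y] is merely admissible for the indices [1] and [2], where an upper bound is what is
   wanted. *)
have [y Hy] := phi0_surj (fun i =>
  (h (a0 i) (b0 i) / (g (a0 i) (b0 i) + h (a0 i) (b0 i)))%:C * phi0 x i).
have -> : wsum phi0 a0 b0 p x = wsum phi0 a0 b0 g y + wsum phi0 a0 b0 h (x - y).
  rewrite -big_split /=; apply: eq_bigr => i _.
  by rewrite phi0B Hy sqmod_par_split ?g0 ?h0.
have le phi a b : (forall i, 0 <= a i) -> (forall i, 0 <= b i) ->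
    (forall u v i, phi (u + v) i = phi u i + phi v i) ->
    wsum phi a b p x <= wsum phi a b g y + wsum phi a b h (x - y).
  move=> ha hb phiD; rewrite -big_split /=; apply: ler_sum => i _.
  rewrite -[in leLHS](subrKC y x) phiD; apply: sqmod_par; [exact: g0|exact: h0].
have := ler_wpM2l t_ge0 (le _ _ _ a1_ge0 b1_ge0 phi1D).
have := ler_wpM2l t'_ge0 (le _ _ _ a2_ge0 b2_ge0 phi2D).
by move: (Hg y) (Hh (x - y)); lra.
Qed.

(** Every iterate of [am_hm] is a concave weight by induction. The arithmetic iterate dominates the
    square root, which serves the indices [1] and [2], and exceeds it by at most [(g + h) / 2^k],
    which is paid at index [0] only. *)
Lemma conc_weight_sqrt g h : weight_ge0 g -> weight_ge0 h ->
  conc_weight g -> conc_weight h ->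
  conc_weight (fun u v => Num.sqrt (g u v * h u v)).
Proof.
move=> g0 h0 Hg Hh.
have H k : let u1 := fun u v => (iter k (@am_hm R) (g u v, h u v)).1 in
    let u2 := fun u v => (iter k (@am_hm R) (g u v, h u v)).2 in
    [/\ weight_ge0 u1, weight_ge0 u2, conc_weight u1 & conc_weight u2].
  elim: k => [//|k [/= P1 P2 C1 C2]]; split.
  - by move=> u v hu hv; rewrite divr_ge0 // addr_ge0 ?P1 ?P2.
  - move=> u v hu hv; rewrite mulr_ge0 // divr_ge0 ?mulr_ge0 ?addr_ge0 //;
    by [apply: P1|apply: P2].
  - have h20 : 0 <= 2^-1 :> R by rewrite invr_ge0.
    apply: eq_conc_weight (conc_weightZ h20 (conc_weightD C1 C2)) => u v _ _.
    by rewrite mulrC.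
  - by apply: conc_weightZ => //; exact: conc_weight_par.
move=> x; set s := fun u v => _.
pose c := wsum phi0 a0 b0 (fun u v => g u v + h u v) x.
apply: (@ge0_le_add_geom _ _ _ c) => k.
have [/= _ _ C1 _] := H k.+1.
have le phi a b : (forall i, 0 <= a i) -> (forall i, 0 <= b i) ->
    wsum phi a b s x <=
    wsum phi a b (fun u v => (iter k.+1 (@am_hm R) (g u v, h u v)).1) x.
  move=> ha hb; apply: ler_wsum => // u v hu hv.
  by have /andP[] := am_hm_sqrt k (g0 _ _ hu hv) (h0 _ _ hu hv).
have := ler_wpM2l t_ge0 (le phi1 _ _ a1_ge0 b1_ge0).
have := ler_wpM2l t'_ge0 (le phi2 _ _ a2_ge0 b2_ge0).
have : wsum phi0 a0 b0 (fun u v => (iter k.+1 (@am_hm R) (g u v, h u v)).1) x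
    <= wsum phi0 a0 b0 s x + c / 2 ^+ k.
  rewrite /c [_ / _]mulrC -wsumZ -wsumD; apply: ler_wsum => // u v hu hv.
  have /andP[_] := am_hm_sqrt k (g0 _ _ hu hv) (h0 _ _ hu hv).
  by rewrite [_^-1 * _]mulrC.
by move: (C1 x); rewrite /=; lra.
Qed.

(** Bisection on the exponent: the weight at the midpoint of two exponents is the geometric mean of
    the weights at the ends. This yields good exponents arbitrarily close to [s]. *)
Lemma conc_weight_bisect g h s k : weight_ge0 g -> weight_ge0 h ->
  conc_weight g -> conc_weight h -> 0 <= s <= 1 ->
  exists lo, [/\ 0 <= lo <= s, s <= lo + 2^-1 ^+ k <= 1,
    conc_weight (fun u v => g u v `^ lo * h u v `^ (1 - lo)) &
    conc_weight (fun u v => g u v `^ (lo + 2^-1 ^+ k) *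
                            h u v `^ (1 - (lo + 2^-1 ^+ k)))].
Proof.
move=> g0 h0 Hg Hh s01; elim: k => [|k [lo [H1 H2 C1 C2]]].
  exists 0; rewrite expr0 add0r; split => //.
  - by rewrite lexx; case/andP: s01.
  - by rewrite lexx andbT; case/andP: s01.
  - apply: eq_conc_weight Hh => u v hu hv.
    by rewrite powRr0 mul1r subr0 powRr1 // h0.
  - apply: eq_conc_weight Hg => u v hu hv.
    by rewrite subrr powRr0 mulr1 powRr1 // g0.
set d := 2^-1 ^+ k in H2 C2; have d0 : 0 < d by rewrite exprn_gt0.
have -> : 2^-1 ^+ k.+1 = d / 2 :> R by rewrite exprSr.
pose m := lo + d / 2.
have Cm : conc_weight (fun u v => g u v `^ m * h u v `^ (1 - m)).
  have P e e' : weight_ge0 (fun u v => g u v `^ e * h u v `^ e').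
    by move=> u v _ _; rewrite mulr_ge0 ?powR_ge0.
  apply: eq_conc_weight (conc_weight_sqrt (P _ _) (P _ _) C1 C2) => u v hu hv.
  have hd (x e f : R) : 0 <= x -> 0 <= e -> 0 <= f -> 0 < e + f ->
      x `^ e * x `^ f = (x `^ ((e + f) / 2)) ^+ 2.
    move=> x0 e0 f0 ef; rewrite -powRD ?(gt_eqF ef) //.
    by rewrite -powR_mulrn ?powR_ge0 // -powRrM; congr (_ `^ _); field.
  rewrite mulrACA !hd ?g0 ?h0 //; try lra.
  rewrite -exprMn sqrtr_sqr ger0_norm ?mulr_ge0 ?powR_ge0 //.
  by congr (_ `^ _ * _ `^ _); rewrite /m; field.
have [sm|ms] := leP s m.
  exists lo; split => //; rewrite -/m ?sm //=; move: H2 => /andP[_]; rewrite /m; lra.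
exists m; have -> : m + d / 2 = lo + d by rewrite /m; field.
split => //; apply/andP; split; rewrite /m in ms *; lra.
Qed.

Lemma conc_weight_geom g h s : weight_ge0 g -> weight_ge0 h ->
  conc_weight g -> conc_weight h -> 0 <= s <= 1 ->
  conc_weight (fun u v => g u v `^ s * h u v `^ (1 - s)).
Proof.
move=> g0 h0 Hg Hh s01.
have [->|sn0] := eqVneq s 0.
  apply: eq_conc_weight Hh => u v hu hv.
  by rewrite powRr0 mul1r subr0 powRr1 // h0.
have [->|sn1] := eqVneq s 1.
  apply: eq_conc_weight Hg => u v hu hv.
  by rewrite subrr powRr0 mulr1 powRr1 // g0.
have {sn0 sn1}s01' : 0 < s < 1.
  by case/andP: s01 => ? ?; rewrite !lt_neqAle eq_sym sn0 sn1; apply/andP.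
(* [F] is the gap in the inequality as a function of the exponent. It is continuous at [s], so a
   negative value there would persist at a nearby exponent [lo] from the bisection, where the gap is
   nonnegative. *)
move=> x; pose F r := wsum phi0 a0 b0 (fun u v => g u v `^ r * h u v `^ (1 - r)) x
  - (t * wsum phi1 a1 b1 (fun u v => g u v `^ r * h u v `^ (1 - r)) x
  + (1 - t) * wsum phi2 a2 b2 (fun u v => g u v `^ r * h u v `^ (1 - r)) x).
rewrite -subr_ge0 -/(F s) leNgt; apply/negP => Fs.
have cw phi a b : (forall i, 0 <= a i) -> (forall i, 0 <= b i) ->
   wsum phi a b (fun u v => g u v `^ r * h u v `^ (1 - r)) x @[r --> s] -->
   wsum phi a b (fun u v => g u v `^ s * h u v `^ (1 - s)) x.
  move=> ha hb; rewrite /wsum; apply: cvg_big => [|i _].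
    by move=> z; exact: add_continuous.
  apply: cvgMl; by apply: continuous_geometric_mean; rewrite ?g0 ?h0.
have cF : F r @[r --> s] --> F s.
  apply: cvgB; first exact: cw.
  by apply: cvgD; apply: cvgMr; apply: cw.
have /cvgrPdist_lt/(_ (- F s)) := cF; rewrite oppr_gt0 => /(_ Fs) [e /= e0 He].
have [k ke] : exists k, 2^-1 ^+ k < e.
  have := @cvg_geometric R 1 2^-1 _.
  rewrite /geometric /=; under eq_fun do rewrite mul1r.
  move=> /(_ _)/cvgrPdist_lt/(_ e e0) => H.
  have [|N _ /(_ N (leqnn N))] := H; first by rewrite ger0_norm; lra.
  by rewrite /= sub0r normrN ger0_norm ?exprn_ge0 // => ?; exists N.
have [lo [/andP[l0 l1] /andP[l2 l3] Clo _]] := conc_weight_bisect k g0 h0 Hg Hh s01.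
have Flo : 0 <= F lo by rewrite subr_ge0; exact: Clo.
have := He lo; rewrite /ball_ /=.
have -> : `|s - lo| < e by rewrite ger0_norm; lra.
by move=> /(_ isT); rewrite ltr_norml; lra.
Qed.

(** Two geometric means: first of [u] and [v] with exponents [p/(p + c)] and [c/(p + c)], then of
    the result and [1] with exponents [p + c] and [1 - (p + c)]. *)
Lemma conc_weight_lieb p c :
  conc_weight (fun u _ => u) -> conc_weight (fun _ v => v) ->
  conc_weight (fun _ _ => 1) ->
  0 <= p -> 0 < c -> p + c <= 1 ->
  conc_weight (fun u v => u `^ p * v `^ c).
Proof.
move=> Ha Hb H1 p0 c0 pc; have pcp : 0 < p + c by lra.
have S : conc_weight (fun u v => u `^ (p / (p + c)) * v `^ (1 - p / (p + c))).
  apply: (@conc_weight_geom (fun u _ => u) (fun _ v => v)) => //.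
  by rewrite divr_ge0 ?ler_pdivrMr //; lra.
have S0 : weight_ge0 (fun u v => u `^ (p / (p + c)) * v `^ (1 - p / (p + c))).
  by move=> u v _ _; rewrite mulr_ge0 ?powR_ge0.
have O0 : weight_ge0 (fun _ _ => 1) by move=> u v _ _; exact: ler01.
have pc01 : 0 <= p + c <= 1 by rewrite pc ltW.
apply: eq_conc_weight (conc_weight_geom S0 O0 S H1 pc01) => u v hu hv.
rewrite powR1 mulr1 powRM ?powR_ge0 // -!powRrM.
by congr (_ `^ _ * _ `^ _); field; rewrite gt_eqF.
Qed.
End ConcaveWeights.

(** * Spectral forms *)

(* [adj] and [spec] are sealed so that unification unfolds neither the
   conjugation of [R[i]] nor the spectral form. *)
HB.lock Definition adj (R : realType) m n (A : 'M[R[i]]_(m, n)) : 'M[R[i]]_(n, m) :=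
  A^t*.

Definition dg (R : realType) n (a : 'I_n -> R) : 'M[R[i]]_n :=
  diag_mx (\row_i (a i)%:C).

HB.lock Definition spec (R : realType) n (U : 'M[R[i]]_n) (a : 'I_n -> R) : 'M[R[i]]_n :=
  adj U *m dg a *m U.

Section Spec.
Variable R : realType.
Local Notation C := R[i].
Implicit Types (m n p k : nat).

Lemma adjE m n (A : 'M[C]_(m, n)) : adj A = A^t*.
Proof. by rewrite adj.unlock. Qed.

Lemma adjM m n p (A : 'M[C]_(m, n)) (B : 'M[C]_(n, p)) :
  adj (A *m B) = adj B *m adj A.
Proof. by rewrite !adjE trmx_mul map_mxM. Qed.

Lemma adj_mxE m n (A : 'M[C]_(m, n)) i j : adj A i j = conjc (A j i).
Proof. by rewrite adjE !mxE. Qed.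

Lemma adjK m n (A : 'M[C]_(m, n)) : adj (adj A) = A.
Proof. by rewrite !adjE trmxCK. Qed.

Lemma adjD m n (A B : 'M[C]_(m, n)) : adj (A + B) = adj A + adj B.
Proof. by apply/matrixP => i j; rewrite mxE !adj_mxE mxE rmorphD. Qed.

Lemma adjmx1 n : adj (1%:M : 'M[C]_n) = 1%:M.
Proof. by rewrite adjE trmx1 map_mx1. Qed.

Lemma mul_conjc_sqmod (z : C) : conjc z * z = (sqmod z)%:C.
Proof. by case: z => a b; rewrite /sqmod; simpc; congr (_ +i* _); ring. Qed.

Lemma sqmod0 : sqmod (0 : C) = 0.
Proof. by rewrite /sqmod /= expr0n addr0. Qed.

Lemma sqmod_eq0 (z : C) : (sqmod z == 0) = (z == 0).
Proof.
case: z => a b; rewrite /sqmod /= paddr_eq0 ?sqr_ge0 // !sqrf_eq0.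
by rewrite eq_complex.
Qed.

Definition unitary n (U : 'M[C]_n) : Prop := U *m adj U = 1%:M.

Lemma unitarymxE n (U : 'M[C]_n) : U \is unitarymx <-> unitary U.
Proof. by rewrite /unitary adjE; split=> /unitarymxP. Qed.

Lemma mul_adj n (U : 'M[C]_n) : unitary U -> U *m adj U = 1%:M.
Proof. by []. Qed.

Lemma adj_mul n (U : 'M[C]_n) : unitary U -> adj U *m U = 1%:M.
Proof. exact: mulmx1C. Qed.

Lemma adj_mulK n p (U : 'M[C]_n) (X : 'M[C]_(p, n)) : unitary U ->
  X *m adj U *m U = X.
Proof. by move=> Uu; rewrite -mulmxA (adj_mul Uu) mulmx1. Qed.

Lemma mul_adjK n p (U : 'M[C]_n) (X : 'M[C]_(p, n)) : unitary U ->
  X *m U *m adj U = X.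
Proof. by move=> Uu; rewrite -mulmxA (mul_adj Uu) mulmx1. Qed.

Lemma unitary_adj n (U : 'M[C]_n) : unitary U -> unitary (adj U).
Proof. by move=> Uu; rewrite /unitary adjK adj_mul. Qed.

Lemma unitary1 n : unitary (1%:M : 'M[C]_n).
Proof. by rewrite /unitary adjmx1 mulmx1. Qed.

Lemma unitary_mul n (U W : 'M[C]_n) : unitary U -> unitary W -> unitary (U *m W).
Proof. by move=> Uu Wu; rewrite /unitary adjM !mulmxA (mul_adjK _ Wu). Qed.

Lemma unitary_spectralmx n (A : 'M[C]_n) : unitary (spectralmx A).
Proof. exact/unitarymxE/spectral_unitarymx. Qed.

Lemma dgE n (a : 'I_n -> R) i j : dg a i j = (a i)%:C *+ (i == j).
Proof. by rewrite !mxE. Qed.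

Lemma eq_dg n (a b : 'I_n -> R) : a =1 b -> dg a = dg b.
Proof. by move=> ab; apply/matrixP => i j; rewrite !dgE ab. Qed.

Lemma dg_adj n (a : 'I_n -> R) : adj (dg a) = dg a.
Proof.
apply/matrixP => i j; rewrite adj_mxE !dgE eq_sym.
by case: eqVneq => [->|_]; rewrite ?conjc_real ?conjc0.
Qed.

Lemma dgM n (a b : 'I_n -> R) : dg a *m dg b = dg (fun i => a i * b i).
Proof.
rewrite /dg mulmx_diag; congr diag_mx; apply/rowP => i.
by rewrite !mxE rmorphM.
Qed.

Lemma dgD n (a b : 'I_n -> R) : dg a + dg b = dg (fun i => a i + b i).
Proof.
by apply/matrixP => i j; rewrite mxE !dgE rmorphD mulrnDl.
Qed.

Lemma dgZ n c (a : 'I_n -> R) : c%:C *: dg a = dg (fun i => c * a i).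
Proof.
by apply/matrixP => i j; rewrite mxE !dgE rmorphM mulrnAr.
Qed.

Lemma dg_const n (c : R) : dg (fun _ : 'I_n => c) = (c%:C)%:M.
Proof. by apply/matrixP => i j; rewrite dgE mxE. Qed.

Lemma mul_dg n p (a : 'I_n -> R) (X : 'M[C]_(p, n)) i j :
  (X *m dg a) i j = X i j * (a j)%:C.
Proof. by rewrite mul_mx_diag !mxE. Qed.

Lemma specE n (U : 'M[C]_n) (a : 'I_n -> R) : spec U a = adj U *m dg a *m U.
Proof. by rewrite spec.unlock. Qed.

Lemma eq_spec n (U : 'M[C]_n) a b : a =1 b -> spec U a = spec U b.
Proof. by move=> ab; rewrite !specE (eq_dg ab). Qed.

Lemma spec_adj n (U : 'M[C]_n) a : adj (spec U a) = spec U a.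
Proof. by rewrite !specE !adjM adjK dg_adj mulmxA. Qed.

Lemma spec_herm n (U : 'M[C]_n) a : spec U a \is hermsymmx.
Proof. by apply/is_hermitianmxP; rewrite expr0 scale1r -adjE spec_adj. Qed.

Lemma specM n (U : 'M[C]_n) a b : unitary U ->
  spec U a *m spec U b = spec U (fun i => a i * b i).
Proof.
by move=> Uu; rewrite !specE -dgM !mulmxA (mul_adjK _ Uu).
Qed.

Lemma specD n (U : 'M[C]_n) a b :
  spec U a + spec U b = spec U (fun i => a i + b i).
Proof. by rewrite !specE -dgD mulmxDr mulmxDl. Qed.

Lemma specZ n (U : 'M[C]_n) c a :
  c%:C *: spec U a = spec U (fun i => c * a i).
Proof. by rewrite !specE -dgZ -scalemxAr -scalemxAl. Qed.

Lemma spec_const n (U : 'M[C]_n) c : unitary U ->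
  spec U (fun=> c) = (c%:C)%:M.
Proof.
by move=> Uu; rewrite !specE dg_const scalar_mxC (adj_mulK _ Uu).
Qed.

Lemma spec_conj n (U W : 'M[C]_n) a :
  adj W *m spec U a *m W = spec (U *m W) a.
Proof. by rewrite !specE adjM !mulmxA. Qed.

Lemma spectral_decomp n (A : 'M[C]_n) : A \is hermsymmx ->
  A = adj (spectralmx A) *m diag_mx (spectral_diag A) *m spectralmx A.
Proof.
move=> /hermitian_normalmx/orthomx_spectralP {1}->.
by rewrite adjE (invmx_unitary (spectral_unitarymx A)).
Qed.

(** The functional calculus does not depend on the diagonalization: [W = P U^*] intertwines the two
    diagonals, so an entry [W i j] vanishes unless [d_i = e_j], and then [W] also intertwines their
    images under [f]. *)
Lemma mxfun_diag n (P U : 'M[C]_n) (f : C -> C) (d e : 'rV[C]_n) :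
  unitary P -> unitary U ->
  adj P *m diag_mx d *m P = adj U *m diag_mx e *m U ->
  adj P *m diag_mx (map_mx f d) *m P = adj U *m diag_mx (map_mx f e) *m U.
Proof.
move=> Pu Uu PU; pose W := P *m adj U.
have Wd : diag_mx d *m W = W *m diag_mx e.
  transitivity (P *m (adj P *m diag_mx d *m P) *m adj U).
    by rewrite /W !mulmxA (mul_adj Pu) mul1mx.
  by rewrite PU /W !mulmxA (mul_adjK _ Uu).
have WD : diag_mx (map_mx f d) *m W = W *m diag_mx (map_mx f e).
  apply/matrixP => i j; have /matrixP/(_ i j) := Wd.
  rewrite !mul_mx_diag !mul_diag_mx !mxE => /eqP.
  rewrite mulrC -subr_eq0 -mulrBr mulf_eq0 subr_eq0 => /orP[/eqP ->|/eqP ->].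
    by rewrite mulr0 mul0r.
  by rewrite mulrC.
have -> : adj P *m diag_mx (map_mx f d) *m P =
    adj P *m (diag_mx (map_mx f d) *m W) *m U.
  by rewrite /W !mulmxA (adj_mulK _ Uu).
by rewrite WD /W !mulmxA (adj_mul Pu) mul1mx.
Qed.

Lemma mxfun_spec n (U : 'M[C]_n) (f : R -> R) a : unitary U ->
  mxfun f (spec U a) = spec U (fun i => f (a i)).
Proof.
move=> Uu; have Pu := unitary_spectralmx (spec U a).
rewrite /mxfun (invmx_unitary (spectral_unitarymx _)) -adjE.
have := spectral_decomp (spec_herm U a); rewrite {1}specE => /esym.
move=> /(mxfun_diag (fun z => (f (complex.Re z))%:C) Pu Uu) ->.
by rewrite specE; congr (_ *m diag_mx _ *m _); apply/rowP => i; rewrite !mxE.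
Qed.

Lemma mxpow_spec n (U : 'M[C]_n) s a : unitary U ->
  mxpow (spec U a) s = spec U (fun i => a i `^ s).
Proof. exact: mxfun_spec. Qed.

Definition nondecr n (a : 'I_n -> R) := forall i j : 'I_n, (i <= j)%N -> a i <= a j.

Lemma sort_perm n (a : 'I_n -> R) : exists s : 'S_n, nondecr (a \o s).
Proof.
pose r (i j : 'I_n) := a i <= a j; pose l := sort r (enum 'I_n).
have sl : size l = n by rewrite size_sort size_enum_ord.
have ul : uniq l by rewrite sort_uniq enum_uniq.
pose f (i : 'I_n) := nth i l i.
have fE (x i : 'I_n) : f i = nth x l i by rewrite /f (set_nth_default x) ?sl.
have fi : injective f.
  move=> i j; rewrite (fE i j) /f => /eqP.
  by rewrite nth_uniq ?sl // => /eqP/val_inj.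
exists (perm fi) => i j ij; rewrite /= !permE (fE i j) /f.
have rt : transitive r by move=> ? ? ?; exact: le_trans.
have rr : reflexive r by move=> ?; exact: lexx.
apply: (sorted_leq_nth rt rr) => //; rewrite ?inE ?sl //.
by apply: sort_sorted => ? ?; exact: le_total.
Qed.

Lemma spec_perm n (U : 'M[C]_n) a (s : 'S_n) :
  spec (perm_mx s *m U) (a \o s) = spec U a.
Proof.
rewrite !specE adjM (adjE (perm_mx s)) tr_perm_mx map_perm_mx !mulmxA.
congr (_ *m _); rewrite -!mulmxA; congr (_ *m _).
rewrite mulmxA -[X in _ *m perm_mx X]invgK -col_permE -row_permE.
by apply/matrixP => i j; rewrite !mxE /= !permKV (inj_eq perm_inj).
Qed.

Lemma unitary_perm_mx n (s : 'S_n) : unitary (perm_mx s : 'M[C]_n).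
Proof.
by rewrite /unitary adjE tr_perm_mx map_perm_mx -perm_mxM mulgV perm_mx1.
Qed.

Lemma spectral_sorted n (A : 'M[C]_n) : A \is hermsymmx ->
  exists U a, [/\ unitary U, nondecr a & A = spec U a].
Proof.
move=> hA; have AP := spectral_decomp hA.
have Pu := unitary_spectralmx A.
pose a i := complex.Re (spectral_diag A 0 i).
have AE : A = spec (spectralmx A) a.
  rewrite {1}AP !specE; congr (_ *m diag_mx _ *m _).
  apply/rowP => i; rewrite mxE /a RRe_real //.
  by have /mxOverP := hermitian_spectral_diag_real hA.
have [s sa] := sort_perm a.
exists (perm_mx s *m spectralmx A), (a \o s); split; last by rewrite spec_perm.
  exact: unitary_mul (unitary_perm_mx s) Pu.
exact: sa.
Qed.

(** For a column [X] this is the quadratic form of [A], for [X = 1] the trace, and for [A = 1] the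
    squared Frobenius norm of [X]. The trace is already real when [A] is Hermitian. *)
Definition tf n p (A : 'M[C]_n) (X : 'M[C]_(n, p)) : R :=
  complex.Re (\tr (adj X *m A *m X)).

Lemma tr_adj_mul n p (Y : 'M[C]_(n, p)) (a : 'I_n -> R) :
  \tr (adj Y *m dg a *m Y) = (\sum_i \sum_j a i * sqmod (Y i j))%:C.
Proof.
rewrite exchange_big rmorph_sum; apply: eq_bigr => j _ /=.
rewrite mxE rmorph_sum; apply: eq_bigr => i _ /=.
by rewrite mul_dg adj_mxE mulrAC mul_conjc_sqmod -rmorphM mulrC.
Qed.

Lemma tf_spec n p (U : 'M[C]_n) a (X : 'M[C]_(n, p)) :
  tf (spec U a) X = \sum_i \sum_j a i * sqmod ((U *m X) i j).
Proof. by rewrite /tf !specE !mulmxA -adjM -!mulmxA !mulmxA -(mulmxA _ U) tr_adj_mul. Qed.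

Lemma tf1 n p (X : 'M[C]_(n, p)) : tf 1%:M X = \sum_i \sum_j sqmod (X i j).
Proof.
rewrite /tf -(rmorph1 (real_complex R)) -dg_const tr_adj_mul /=.
by under eq_bigr do under eq_bigr do rewrite mul1r.
Qed.

Lemma tf_mul n m p (M : 'M[C]_(n, m)) (A : 'M[C]_n) (X : 'M[C]_(m, p)) :
  tf A (M *m X) = tf (adj M *m A *m M) X.
Proof. by rewrite /tf adjM !mulmxA. Qed.

Lemma tf_gram n m p (M : 'M[C]_(n, m)) (X : 'M[C]_(m, p)) :
  tf (adj M *m M) X = tf 1%:M (M *m X).
Proof. by rewrite tf_mul mulmx1. Qed.

Lemma tfD n p (A B : 'M[C]_n) (X : 'M[C]_(n, p)) :
  tf (A + B) X = tf A X + tf B X.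
Proof. by rewrite /tf mulmxDr mulmxDl mxtraceD raddfD. Qed.

Lemma tfZ n p c (A : 'M[C]_n) (X : 'M[C]_(n, p)) :
  tf (c%:C *: A) X = c * tf A X.
Proof.
rewrite /tf -scalemxAr -scalemxAl mxtraceZ; case: (\tr _) => a b /=.
by rewrite mul0r subr0.
Qed.

Lemma tf1_ge0 n p (X : 'M[C]_(n, p)) : 0 <= tf 1%:M X.
Proof. by rewrite tf1; do 2!apply: sumr_ge0 => ? _; exact: sqmod_ge0. Qed.

Lemma tf1_gt0 n p (X : 'M[C]_(n, p)) : X != 0 -> 0 < tf 1%:M X.
Proof.
move=> X0; rewrite lt0r tf1_ge0 andbT; apply: contra_neq X0 => /eqP.
rewrite tf1 psumr_eq0 => [/allP H|i _]; last by apply: sumr_ge0 => *; exact: sqmod_ge0.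
apply/matrixP => i j; have := H i (mem_index_enum _).
rewrite psumr_eq0 => [/allP/(_ j (mem_index_enum _))|? _]; last exact: sqmod_ge0.
by rewrite /= sqmod_eq0 mxE => /eqP.
Qed.

Lemma tf_unitary n p (U : 'M[C]_n) (X : 'M[C]_(n, p)) : unitary U ->
  tf 1%:M (U *m X) = tf 1%:M X.
Proof. by move=> Uu; rewrite tf_mul mulmx1 (adj_mul Uu). Qed.

Lemma tf_spec_eigen n (U : 'M[C]_n) a i : unitary U ->
  tf (spec U a) (adj U *m delta_mx i (0 : 'I_1)) = a i.
Proof.
move=> Uu; rewrite tf_spec mulmxA (mul_adj Uu) mul1mx (bigD1 i) //=.
rewrite big_ord1 big1 ?addr0 => [|j ji]; rewrite ?big_ord1 !mxE ?eqxx ?(negbTE ji) /=.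
  by rewrite -(rmorph1 (real_complex R)) sqmod_real expr1n mulr1.
by rewrite sqmod0 mulr0.
Qed.

Lemma gram_eig_ge0 n m (M : 'M[C]_(n, m)) U a : unitary U ->
  adj M *m M = spec U a -> forall i, 0 <= a i.
Proof.
by move=> Uu E i; rewrite -(tf_spec_eigen a i Uu) -E tf_gram tf1_ge0.
Qed.

Lemma eigvec_neq0 n (U : 'M[C]_n) i : unitary U ->
  adj U *m delta_mx i (0 : 'I_1) != 0.
Proof.
move=> Uu; apply/eqP => /(congr1 (mulmx U)).
rewrite mulmxA (mul_adj Uu) mul1mx mulmx0 => /matrixP/(_ i 0).
by rewrite !mxE !eqxx => /eqP; rewrite oner_eq0.
Qed.

Lemma posdef_spec n (U : 'M[C]_n) a : unitary U ->
  posdef (spec U a) <-> (forall i, 0 < a i).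
Proof.
move=> Uu.
have E (x : 'cV[C]_n) : (x^t* *m spec U a *m x) 0 0 = (tf (spec U a) x)%:C.
  rewrite tf_spec -tr_adj_mul !specE adjM !mulmxA /mxtrace.
  by rewrite big_ord1 -adjE.
split => [[_ H] i|H].
  by have := H _ (eigvec_neq0 i Uu); rewrite E ltcR tf_spec_eigen.
split=> [|x x0]; first exact: spec_herm.
rewrite E ltcR tf_spec.
have : 0 < tf 1%:M (U *m x) by rewrite tf_unitary // tf1_gt0.
rewrite tf1 => /lt0r_neq0; rewrite psumr_neq0 /=; last first.
  by move=> i _; apply: sumr_ge0 => *; exact: sqmod_ge0.
case/hasP => i _ /= Hi; rewrite (bigD1 i) //= -mulr_sumr.
rewrite ltr_wpDr ?mulr_gt0 ?H //; apply: sumr_ge0 => j _; apply: sumr_ge0 => k _.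
by rewrite mulr_ge0 ?sqmod_ge0 // ltW.
Qed.

Lemma tf_posdef n (A : 'M[C]_n) (v : 'cV[C]_n) : posdef A -> v != 0 -> 0 < tf A v.
Proof.
move=> [_ H] /H; rewrite ltcE => /andP[_] /=.
by rewrite /tf /mxtrace big_ord1 adjE.
Qed.

Lemma posdefP n (A : 'M[C]_n) : posdef A ->
  exists U a, [/\ unitary U, nondecr a, forall i, 0 < a i & A = spec U a].
Proof.
move=> pA; have [U [a [Uu na AE]]] := spectral_sorted pA.1.
by exists U, a; split => //; apply/(posdef_spec _ Uu); rewrite -AE.
Qed.

Lemma adjZ m n (c : R) (A : 'M[C]_(m, n)) : adj (c%:C *: A) = c%:C *: adj A.
Proof.
apply/matrixP => i j.
by rewrite adj_mxE [LHS]/= !mxE adj_mxE -[in RHS](conjc_real c) -rmorphM.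
Qed.

Lemma posdef_convex n (A B : 'M[C]_n) t : 0 <= t <= 1 -> posdef A -> posdef B ->
  posdef (t%:C *: A + (1 - t)%:C *: B).
Proof.
move=> /andP[t0 t1] pA pB.
have Ch : t%:C *: A + (1 - t)%:C *: B \is hermsymmx.
  apply/is_hermitianmxP; rewrite expr0 scale1r -adjE adjD !adjZ !adjE.
  have /is_hermitianmxP := pA.1; have /is_hermitianmxP := pB.1.
  by rewrite !expr0 !scale1r => <- <-.
have [W [c [Wu _ CE]]] := spectral_sorted Ch.
rewrite CE; apply/(posdef_spec _ Wu) => i.
rewrite -(tf_spec_eigen c i Wu) -CE tfD !tfZ.
have v0 := eigvec_neq0 i Wu.
have := tf_posdef pA v0; have := tf_posdef pB v0; move: (tf A _) (tf B _) => x y y0 x0.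
have [->|tn1] := eqVneq t 1; first by rewrite mul1r subrr mul0r addr0.
have t1' : 0 < 1 - t by rewrite subr_gt0 lt_neqAle tn1.
by rewrite ltr_wpDl ?mulr_gt0 // mulr_ge0 // ltW.
Qed.

End Spec.

(** * Eigenvalue inequalities *)

Section MinMax.
Variable R : realType.
Local Notation C := R[i].
Implicit Types (m n p k : nat).

(** There are [j + (k - 1 - j) = k - 1] linear conditions on [k] unknowns. They are stacked into a
    square matrix whose row [j] is zero, hence singular. *)
Lemma zero_coords k (F G : 'M[C]_k) (j : 'I_k) : exists2 x : 'cV[C]_k, x != 0 &
  (forall i : 'I_k, (i < j)%N -> (F *m x) i 0 = 0) /\
  (forall i : 'I_k, (j < i)%N -> (G *m x) i 0 = 0).
Proof.
pose E : 'M[C]_k := \matrix_(i, l)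
  if (i < j)%N then F i l else if (j < i)%N then G i l else 0.
have dE : \det E^T == 0.
  rewrite det_tr (expand_det_row E j) big1 // => l _.
  by rewrite mxE ltnn mul0r.
have /det0P[v v0 vE] := dE.
have Ev : E *m v^T = 0 by rewrite -[E]trmxK -trmx_mul vE trmx0.
exists v^T; first by rewrite -(inj_eq (can_inj (@trmxK _ _ _))) trmxK trmx0.
split => i ij; have /matrixP/(_ i 0) := Ev; rewrite [RHS]mxE => <-;
  rewrite [LHS]mxE [RHS]mxE; apply: eq_bigr => l _; rewrite [E i l]mxE.
- by rewrite ij.
- by rewrite ij ltnNge (ltnW ij).
Qed.

Lemma ler_tf_spec n (U : 'M[C]_n) a (x : 'cV[C]_n) c : unitary U ->
  (forall i, (U *m x) i 0 = 0 \/ a i <= c) ->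
  tf (spec U a) x <= c * tf 1%:M x.
Proof.
move=> Uu H; rewrite -(tf_unitary x Uu) tf1 tf_spec mulr_sumr.
apply: ler_sum => i _; rewrite !big_ord1; case: (H i) => [->|ac].
  by rewrite sqmod0 !mulr0.
by rewrite ler_wpM2r ?sqmod_ge0.
Qed.

Lemma ger_tf_spec n (U : 'M[C]_n) a (x : 'cV[C]_n) c : unitary U ->
  (forall i, (U *m x) i 0 = 0 \/ c <= a i) ->
  c * tf 1%:M x <= tf (spec U a) x.
Proof.
move=> Uu H; rewrite -(tf_unitary x Uu) tf1 tf_spec mulr_sumr.
apply: ler_sum => i _; rewrite !big_ord1; case: (H i) => [->|ac].
  by rewrite sqmod0 !mulr0.
by rewrite ler_wpM2r ?sqmod_ge0.
Qed.

(* Cauchy interlacing and, for [k = n], Weyl monotonicity. *)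
Lemma interlacing n k (kn : (k <= n)%N) (V : 'M[C]_(n, k)) (U : 'M[C]_n)
    (F : 'M[C]_k) a b :
  adj V *m V = 1%:M -> unitary U -> unitary F ->
  nondecr a -> nondecr b ->
  (forall x : 'cV[C]_k, tf (spec U a) (V *m x) <= tf (spec F b) x) ->
  forall j : 'I_k, a (widen_ord kn j) <= b j.
Proof.
move=> VV Uu Fu na nb H j.
(* [V x] has no component on the first [j] eigenvectors of [spec U a], and [x] has none on the
   eigenvectors of [spec F b] after [j]. So the first form is at least [a_j] and the second at most
   [b_j] times the squared norm. *)
have [x x0 [Hlo Hhi]] := zero_coords (\matrix_(i, l) (U *m V) (widen_ord kn i) l) F j.
have Vx : tf 1%:M (V *m x) = tf 1%:M x by rewrite tf_mul mulmx1 VV.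
have lo : a (widen_ord kn j) * tf 1%:M (V *m x) <= tf (spec U a) (V *m x).
  apply: ger_tf_spec => // i; have [ij|ji] := ltnP i j; last by right; exact: na.
  left; have ik : (i < k)%N := ltn_trans ij (ltn_ord j).
  have [i' ii'] : exists i' : 'I_k, i = widen_ord kn i'.
    by exists (Ordinal ik); exact: val_inj.
  rewrite ii' in ij *; rewrite mulmxA -(Hlo i' ij); rewrite [LHS]mxE [RHS]mxE.
  by apply: eq_bigr => l _; rewrite [X in _ = X * _]mxE.
have hi : tf (spec F b) x <= b j * tf 1%:M x.
  apply: ler_tf_spec => // i; have [ij|ji] := leqP i j; first by right; exact: nb.
  by left; exact: Hhi.
by rewrite -(ler_pM2r (tf1_gt0 x0)) -{1}Vx
  (le_trans lo) // (le_trans (H x)).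
Qed.

Lemma weyl_mono n (U W : 'M[C]_n) a b :
  unitary U -> unitary W -> nondecr a -> nondecr b ->
  (forall x : 'cV[C]_n, tf (spec U a) x <= tf (spec W b) x) ->
  forall j, a j <= b j.
Proof.
move=> Uu Wu na nb H j.
have := @interlacing n n (leqnn n) 1%:M U W a b _ Uu Wu na nb _ j.
rewrite adjmx1 mulmx1 => /(_ erefl).
have -> : widen_ord (leqnn n) j = j by exact: val_inj.
by apply=> x; rewrite mul1mx.
Qed.

Lemma gram_eig_le n (M U W : 'M[C]_n) a b :
  unitary U -> unitary W -> nondecr a -> nondecr b ->
  adj M *m M = spec U a -> M *m adj M = spec W b -> forall j, a j <= b j.
Proof.
move=> Uu Wu na nb Ea Eb j.
have a0 := gram_eig_ge0 Uu Ea.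
have b0 : forall i, 0 <= b i by apply: (gram_eig_ge0 (M := adj M) Wu); rewrite adjK.
have [aj0|ajn0] := eqVneq (a j) 0; first by rewrite aj0.
have ajp : 0 < a j by rewrite lt0r ajn0 a0.
have [x x0 [Hlo Hhi]] := zero_coords U (W *m M) j.
have cond i : (U *m x) i 0 = 0 \/ a j <= a i.
  by have [ij|ji] := ltnP i j; [left; exact: Hlo|right; exact: na].
have y0 : 0 < tf 1%:M (M *m x).
  rewrite -tf_gram Ea; apply: lt_le_trans (ger_tf_spec Uu cond).
  by rewrite mulr_gt0 ?tf1_gt0.
have lo : a j * tf 1%:M (M *m x) <= tf (spec W b) (M *m x).
  rewrite -Eb (tf_mul M (M *m adj M)) !mulmxA Ea -mulmxA Ea (specM _ _ Uu).
  rewrite -tf_gram Ea !tf_spec mulr_sumr; apply: ler_sum => i _.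
  rewrite !big_ord1 mulrA ; case: (cond i) => [->|ai]; first by rewrite sqmod0 !mulr0.
  by rewrite ler_wpM2r ?sqmod_ge0 // ler_wpM2r.
have hi : tf (spec W b) (M *m x) <= b j * tf 1%:M (M *m x).
  apply: ler_tf_spec => // i; have [ij|ji] := leqP i j; first by right; exact: nb.
  by left; rewrite mulmxA; exact: Hhi.
by rewrite -(ler_pM2r y0) (le_trans lo).
Qed.

Lemma gram_eig_eq n (M U W : 'M[C]_n) a b :
  unitary U -> unitary W -> nondecr a -> nondecr b ->
  adj M *m M = spec U a -> M *m adj M = spec W b -> a =1 b.
Proof.
move=> Uu Wu na nb Ea Eb j; apply/le_anti/andP; split.
  exact: gram_eig_le Uu Wu na nb Ea Eb j.
by apply: (gram_eig_le (M := adj M) Wu Uu nb na); rewrite adjK.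
Qed.

End MinMax.

(** * Lieb's and Epstein's concavity theorems *)

Section Epstein.
Variable R : realType.
Local Notation C := R[i].
Implicit Types (m n p k : nat).

Lemma sqmod_conjc (z : C) : sqmod (conjc z) = sqmod z.
Proof. by case: z => a b; rewrite /sqmod /= sqrrN. Qed.

Lemma tf_spec_ge0 n p (U : 'M[C]_n) a (X : 'M[C]_(n, p)) :
  (forall i, 0 <= a i) -> 0 <= tf (spec U a) X.
Proof.
move=> a0; rewrite tf_spec; do 2!apply: sumr_ge0 => ? _.
by rewrite mulr_ge0 ?sqmod_ge0.
Qed.

Lemma tf_unitary_r n p (A : 'M[C]_n) (X : 'M[C]_(n, p)) (W : 'M[C]_p) :
  unitary W -> tf A (X *m adj W) = tf A X.
Proof.
move=> Wu; rewrite /tf adjM adjK -!mulmxA mxtrace_mulC !mulmxA.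
by rewrite (adj_mulK _ Wu).
Qed.

Lemma spec_trace n (U : 'M[C]_n) a : unitary U ->
  tf (spec U a) 1%:M = \sum_i a i.
Proof.
move=> Uu; rewrite -(tf_unitary_r _ _ Uu) mul1mx tf_spec (mul_adj Uu).
apply: eq_bigr => i _; rewrite (bigD1 i) //= big1 => [|j ji]; rewrite mxE.
  by rewrite eqxx -(rmorph1 (real_complex R)) sqmod_real expr1n mulr1 addr0.
by rewrite eq_sym (negbTE ji) sqmod0 mulr0.
Qed.

Lemma unitary_row_sum n (Q : 'M[C]_n) i : unitary Q ->
  \sum_j sqmod (Q i j) = 1.
Proof.
move=> Qu; have /matrixP/(_ i i) := mul_adj Qu; rewrite !mxE eqxx.
under eq_bigr do rewrite adj_mxE mulrC mul_conjc_sqmod.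
by rewrite -rmorph_sum /= => -[].
Qed.

Lemma unitary_col_sum n (Q : 'M[C]_n) j : unitary Q ->
  \sum_i sqmod (Q i j) = 1.
Proof.
move=> Qu; rewrite -(unitary_row_sum j (unitary_adj Qu)).
by apply: eq_bigr => i _; rewrite adj_mxE sqmod_conjc.
Qed.

(** With [z] the weighted mean, Young's inequality gives [y_i^s z^(1 - s) <= s y_i + (1 - s) z]. The
    right-hand sides average to [z], and dividing by [z^(1 - s)] finishes. *)
Lemma jensen_powR (I : finType) (w y : I -> R) s : 0 < s <= 1 ->
  (forall i, 0 <= w i) -> \sum_i w i = 1 -> (forall i, 0 <= y i) ->
  \sum_i w i * y i `^ s <= (\sum_i w i * y i) `^ s.
Proof.
move=> /andP[s0]; rewrite le_eqVlt => /orP[/eqP -> w0 _ y0|s1 w0 w1 y0].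
  rewrite powRr1; last by apply: sumr_ge0 => i _; rewrite mulr_ge0.
  by under eq_bigr do rewrite powRr1 //.
set z := \sum_i _ * y i; have z0 : 0 <= z by apply: sumr_ge0 => i _; rewrite mulr_ge0.
have [zE|zn0] := eqVneq z 0.
  rewrite zE powR0 ?gt_eqF // big1 // => i _.
  have /eqP := zE; rewrite psumr_eq0 => [/allP/(_ i (mem_index_enum _))|? _]; last first.
    by rewrite mulr_ge0.
  by rewrite /= mulf_eq0 => /orP[|] /eqP ->; rewrite ?mul0r // powR0 ?mulr0 ?gt_eqF.
have zp : 0 < z by rewrite lt0r zn0.
have s01 : 0 < s < 1 by rewrite s0.
rewrite -(ler_pM2r (powR_gt0 (1 - s) zp)) -powRD; last by rewrite zn0 implybT.
have -> : s + (1 - s) = 1 by ring.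
rewrite powRr1 // mulr_suml.
have zE : \sum_i w i * (s * y i + (1 - s) * z) = z.
  under eq_bigr do rewrite mulrDr mulrCA.
  by rewrite big_split /= -mulr_sumr -/z -mulr_suml w1; ring.
rewrite -[leRHS]zE.
by apply: ler_sum => i _; rewrite -mulrA ler_wpM2l // young.
Qed.

Lemma concave_powR (t x y s : R) : 0 < s <= 1 -> 0 <= t <= 1 -> 0 <= x -> 0 <= y ->
  t * x `^ s + (1 - t) * y `^ s <= (t * x + (1 - t) * y) `^ s.
Proof.
move=> s01 /andP[t0 t1] x0 y0.
have := @jensen_powR bool (fun b => if b then t else 1 - t)
  (fun b => if b then x else y) s s01.
rewrite !big_bool /=; apply; try by case; rewrite ?subr_ge0.
by ring.
Qed.

(** * Lieb's concavity theorem in the coordinates of the eigenbases *)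

Section Lieb.
Variables (n m : nat) (t : R) (U0 U1 U2 : 'M[C]_n) (W0 W1 W2 : 'M[C]_m).
Variables (a0 a1 a2 : 'I_n -> R) (b0 b1 b2 : 'I_m -> R).
Hypotheses (U0u : unitary U0) (U1u : unitary U1)
  (U2u : unitary U2) (W0u : unitary W0) (W1u : unitary W1)
  (W2u : unitary W2).
Hypotheses (a0_ge0 : forall i, 0 <= a0 i) (a1_ge0 : forall i, 0 <= a1 i)
  (a2_ge0 : forall i, 0 <= a2 i).
Hypotheses (b0_ge0 : forall i, 0 <= b0 i) (b1_ge0 : forall i, 0 <= b1 i)
  (b2_ge0 : forall i, 0 <= b2 i).
Hypothesis t01 : 0 <= t <= 1.
Hypothesis HA : spec U0 a0 = t%:C *: spec U1 a1 + (1 - t)%:C *: spec U2 a2.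
Hypothesis HB : spec W0 b0 = t%:C *: spec W1 b1 + (1 - t)%:C *: spec W2 b2.

Definition coord (U : 'M[C]_n) (W : 'M[C]_m) (X : 'M[C]_(n, m)) (ij : 'I_n * 'I_m) : C :=
  (U *m X *m adj W) ij.1 ij.2.

Lemma wsum_coord U W a b (g : R -> R -> R) X :
  wsum (coord U W) (fun ij => a ij.1) (fun ij => b ij.2) g X =
  \sum_i \sum_j g (a i) (b j) * sqmod ((U *m X *m adj W) i j).
Proof. by rewrite pair_bigA. Qed.

Definition concave_coord := conc_weight (coord U0 W0) (coord U1 W1) (coord U2 W2)
  (fun ij => a0 ij.1) (fun ij => b0 ij.2) (fun ij => a1 ij.1) (fun ij => b1 ij.2)
  (fun ij => a2 ij.1) (fun ij => b2 ij.2) t.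

Lemma concave_coord_left : concave_coord (fun u _ => u).
Proof.
move=> X; have E U W a b : unitary W ->
    wsum (coord U W) (fun ij => a ij.1) (fun ij => b ij.2) (fun u _ => u) X =
    tf (spec U a) X.
  move=> Wu; rewrite wsum_coord -(tf_unitary_r _ _ Wu) tf_spec.
  by do 2!apply: eq_bigr => ? _; rewrite mulmxA.
by rewrite (E _ _ _ _ W0u) (E _ _ _ _ W1u) (E _ _ _ _ W2u) HA tfD !tfZ.
Qed.

Lemma concave_coord_right : concave_coord (fun _ v => v).
Proof.
move=> X; have E U W a b : unitary U ->
    wsum (coord U W) (fun ij => a ij.1) (fun ij => b ij.2) (fun _ v => v) X =
    tf (spec W b) (adj X).
  move=> Uu; rewrite wsum_coord -(tf_unitary_r _ _ Uu) tf_spec exchange_big.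
  do 2!apply: eq_bigr => ? _; congr (_ * _).
  by rewrite -[in RHS]sqmod_conjc -adj_mxE !adjM !adjK.
by rewrite (E _ _ _ _ U0u) (E _ _ _ _ U1u) (E _ _ _ _ U2u) HB tfD !tfZ.
Qed.

Lemma concave_coord_const : concave_coord (fun _ _ => 1).
Proof.
move=> X; have E U W a b : unitary U -> unitary W ->
    wsum (coord U W) (fun ij => a ij.1) (fun ij => b ij.2) (fun _ _ => 1) X =
    tf 1%:M X.
  move=> Uu Wu; rewrite wsum_coord -(tf_unitary X Uu) -(tf_unitary_r _ _ Wu) tf1.
  by do 2!apply: eq_bigr => ? _; rewrite mul1r.
rewrite (E _ _ _ _ U0u W0u) (E _ _ _ _ U1u W1u) (E _ _ _ _ U2u W2u); lra.
Qed.

Lemma coordD U W x y ij : coord U W (x + y) ij = coord U W x ij + coord U W y ij.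
Proof. by rewrite /coord mulmxDr mulmxDl mxE. Qed.

Lemma coordB U W x y ij : coord U W (x - y) ij = coord U W x ij - coord U W y ij.
Proof. by rewrite /coord mulmxBr mulmxBl !mxE. Qed.

Lemma coord_surj c : exists X, forall ij, coord U0 W0 X ij = c ij.
Proof.
exists (adj U0 *m (\matrix_(i, j) c (i, j)) *m W0) => -[i j].
by rewrite /coord !mulmxA (mul_adj U0u) mul1mx (mul_adjK _ W0u) mxE.
Qed.

Lemma lieb_concavity (p c : R) X : 0 <= p -> 0 < c -> p + c <= 1 ->
  t * (\sum_i \sum_j a1 i `^ p * b1 j `^ c * sqmod ((U1 *m X *m adj W1) i j)) +
  (1 - t) * (\sum_i \sum_j a2 i `^ p * b2 j `^ c * sqmod ((U2 *m X *m adj W2) i j))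
  <= \sum_i \sum_j a0 i `^ p * b0 j `^ c * sqmod ((U0 *m X *m adj W0) i j).
Proof.
move=> p0 c0 pc; rewrite -!(wsum_coord _ _ _ _ (fun u v => u `^ p * v `^ c)).
apply: (conc_weight_lieb (coordB _ _) coord_surj (coordD _ _) (coordD _ _)) => //.
- exact: concave_coord_left.
- exact: concave_coord_right.
- exact: concave_coord_const.
Qed.

(** Operator concavity of [A^p]: the weight [u^p] is the geometric mean of the weights [u] and
    [1]. *)
Lemma tf_powR_concave (p : R) (X : 'M[C]_(n, m)) : 0 <= p <= 1 ->
  t * tf (spec U1 (fun i => a1 i `^ p)) X + (1 - t) * tf (spec U2 (fun i => a2 i `^ p)) X
  <= tf (spec U0 (fun i => a0 i `^ p)) X.
Proof.
move=> p01.
have E U W a b : unitary W ->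
    wsum (coord U W) (fun ij => a ij.1) (fun ij => b ij.2)
      (fun u v => u `^ p * 1 `^ (1 - p)) X = tf (spec U (fun i => a i `^ p)) X.
  move=> Wu; rewrite wsum_coord -(tf_unitary_r _ _ Wu) tf_spec.
  by do 2!apply: eq_bigr => ? _; rewrite mulmxA powR1 mulr1.
rewrite -(E U0 W0 a0 b0 W0u) -(E U1 W1 a1 b1 W1u) -(E U2 W2 a2 b2 W2u).
have g0 : weight_ge0 (fun u _ : R => u) by [].
have h0 : weight_ge0 (fun _ _ : R => 1) by move=> *; exact: ler01.
by apply: (conc_weight_geom (coordB _ _) coord_surj (coordD _ _) (coordD _ _)
  _ _ _ _ _ _ _ g0 h0 concave_coord_left concave_coord_const).
Qed.

End Lieb.


(** Evaluates the trace of [adj X A X B] over the eigenvectors of [B], which brings in the quadratic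
    form of [adj X A X]. *)
Lemma lieb_form n m (U : 'M[C]_n) (W : 'M[C]_m) a b (X : 'M[C]_(n, m)) :
  \sum_i \sum_j a i * b j * sqmod ((U *m X *m adj W) i j) =
  \sum_j b j * tf (spec U a) (X *m (adj W *m delta_mx j (0 : 'I_1))).
Proof.
rewrite exchange_big; apply: eq_bigr => j _; rewrite tf_spec mulr_sumr.
apply: eq_bigr => i _; rewrite big_ord1 !mulmxA mulrA [b j * _]mulrC.
by rewrite -colE [in RHS]mxE.
Qed.

(** * Epstein's trace inequality *)

Section TraceEpstein.
Variables (n k : nat) (t p s : R) (U0 U1 U2 : 'M[C]_n) (F0 F1 F2 : 'M[C]_k).
Variables (a0 a1 a2 : 'I_n -> R) (c0 c1 c2 : 'I_k -> R) (L : 'M[C]_(n, k)).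
Hypotheses (U0u : unitary U0) (U1u : unitary U1)
  (U2u : unitary U2) (F0u : unitary F0) (F1u : unitary F1)
  (F2u : unitary F2).
Hypotheses (a0_ge0 : forall i, 0 <= a0 i) (a1_ge0 : forall i, 0 <= a1 i)
  (a2_ge0 : forall i, 0 <= a2 i).
Hypothesis t01 : 0 <= t <= 1.
Hypothesis HA : spec U0 a0 = t%:C *: spec U1 a1 + (1 - t)%:C *: spec U2 a2.
Hypotheses
  (H0 : adj L *m spec U0 (fun i => a0 i `^ p) *m L = spec F0 c0)
  (H1 : adj L *m spec U1 (fun i => a1 i `^ p) *m L = spec F1 c1)
  (H2 : adj L *m spec U2 (fun i => a2 i `^ p) *m L = spec F2 c2).
Hypotheses (p01 : 0 <= p <= 1) (s_gt0 : 0 < s) (ps1 : p * s <= 1).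

Let t_ge0 : 0 <= t. Proof. by case/andP: t01. Qed.
Let t'_ge0 : 0 <= 1 - t. Proof. by rewrite subr_ge0; case/andP: t01. Qed.

Let eig_ge0 U F a c : unitary U -> unitary F ->
  adj L *m spec U (fun i => a i `^ p) *m L = spec F c -> forall i, 0 <= c i.
Proof.
move=> Uu Fu E i; rewrite -(tf_spec_eigen c i Fu) -E -tf_mul.
by apply: tf_spec_ge0 => ?; exact: powR_ge0.
Qed.

Let c0_ge0 := eig_ge0 U0u F0u H0.
Let c1_ge0 := eig_ge0 U1u F1u H1.
Let c2_ge0 := eig_ge0 U2u F2u H2.

(** In the eigenbasis [e] of the matrix with index [0], the diagonal of any of the three matrices
    arises from its eigenvalues by a doubly stochastic matrix, so Jensen bounds the trace of its
    power [s] by the sum of the powers of the diagonal entries. What remains is a scalar inequality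
    for each [e i], from the concavity of [x^s] and of [A^p]. *)
Lemma trace_epstein_le1 : s <= 1 ->
  t * (\sum_i c1 i `^ s) + (1 - t) * (\sum_i c2 i `^ s) <= \sum_i c0 i `^ s.
Proof.
move=> s1; have s01 : 0 < s <= 1 by rewrite s_gt0.
pose e i : 'cV[C]_k := adj F0 *m delta_mx i 0.
have peierls U F a c : unitary U -> unitary F ->
    adj L *m spec U (fun i => a i `^ p) *m L = spec F c ->
    \sum_i c i `^ s <= \sum_i tf (spec F c) (e i) `^ s.
  move=> Uu Fu E; have c_ge0 := eig_ge0 Uu Fu E.
  have Qu : unitary (F *m adj F0) := unitary_mul Fu (unitary_adj F0u).
  have -> : \sum_i c i `^ s =
      \sum_i \sum_j sqmod ((F *m adj F0) j i) * c j `^ s.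
    rewrite exchange_big; apply: eq_bigr => j _.
    by rewrite -mulr_suml unitary_row_sum // mul1r.
  apply: ler_sum => i _; apply: le_trans (jensen_powR s01 _ _ _) _.
  - by move=> j; exact: sqmod_ge0.
  - exact: unitary_col_sum.
  - exact: c_ge0.
  rewrite tf_spec /e mulmxA -colE.
  by under [in leRHS]eq_bigr do rewrite big_ord1 mxE mulrC.
have combine (x1 x2 : 'I_k -> R) : \sum_i c1 i `^ s <= \sum_i x1 i ->
    \sum_i c2 i `^ s <= \sum_i x2 i ->
    (forall i, t * x1 i + (1 - t) * x2 i <= c0 i `^ s) ->
    t * (\sum_i c1 i `^ s) + (1 - t) * (\sum_i c2 i `^ s) <= \sum_i c0 i `^ s.
  move=> le1 le2 le0; apply: le_trans (ler_sum _ (fun i _ => le0 i)).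
  by rewrite big_split /= -!mulr_sumr; apply: lerD; apply: ler_wpM2l.
apply: (combine _ _ (peierls _ _ _ _ U1u F1u H1) (peierls _ _ _ _ U2u F2u H2)) => i.
have tf_ge0 U F a c j : unitary U -> unitary F ->
    adj L *m spec U (fun i => a i `^ p) *m L = spec F c ->
    0 <= tf (spec F c) (e j).
  by move=> Uu Fu E; apply: tf_spec_ge0; exact: eig_ge0 E.
have x_ge0 := tf_ge0 _ _ _ _ i U1u F1u H1.
have y_ge0 := tf_ge0 _ _ _ _ i U2u F2u H2.
apply: le_trans (concave_powR s01 t01 x_ge0 y_ge0) _.
have z_ge0 : 0 <= t * tf (spec F1 c1) (e i) + (1 - t) * tf (spec F2 c2) (e i).
  exact: addr_ge0 (mulr_ge0 t_ge0 x_ge0) (mulr_ge0 t'_ge0 y_ge0).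
apply: (ge0_ler_powR (ltW s_gt0)); [exact: z_ge0|exact: c0_ge0|].
rewrite -[leRHS](tf_spec_eigen c0 i F0u) -/(e i) -H0 -H1 -H2.
rewrite -(tf_mul L (spec U0 _)) -(tf_mul L (spec U1 _)) -(tf_mul L (spec U2 _)).
exact: (tf_powR_concave U0u U1u U2u (unitary1 _ 1) (unitary1 _ 1) (unitary1 _ 1)
  a0_ge0 a1_ge0 a2_ge0 (fun=> lexx 0) (fun=> lexx 0) (fun=> lexx 0) t01 HA _ p01).
Qed.

(* Duality of Carlen and Lieb: Young's inequality bounds [s tr (M B^(1 - 1/s))] by
   [tr (M^s) + (s - 1) tr B], with equality for [B = M^s]; it is applied with
   [B = t M1^s + (1 - t) M2^s]. *)
Lemma trace_epstein_gt1 : 1 < s ->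
  t * (\sum_i c1 i `^ s) + (1 - t) * (\sum_i c2 i `^ s) <= \sum_i c0 i `^ s.
Proof.
move=> s1; set T := leLHS.
pose B := t%:C *: spec F1 (fun i => c1 i `^ s) + (1 - t)%:C *: spec F2 (fun i => c2 i `^ s).
have Bh : B \is hermsymmx.
  apply/is_hermitianmxP; rewrite expr0 scale1r -adjE /B !specZ.
  by rewrite adjD !spec_adj.
have [W [b [Wu _ BE]]] := spectral_sorted Bh.
have b_ge0 i : 0 <= b i.
  rewrite -(tf_spec_eigen b i Wu) -BE tfD !tfZ addr_ge0 // mulr_ge0 //;
  by apply: tf_spec_ge0 => ?; exact: powR_ge0.
have TE : \sum_j b j = T.
  by rewrite -(spec_trace b Wu) -BE tfD !tfZ !spec_trace.
(* The exponent of [B] in the dual expression; [p + c <= 1], as Lieb's theorem requires, amounts to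
   [p s <= 1]. *)
pose c := 1 - s^-1.
have s10 : 0 < s^-1 < 1 by rewrite invr_gt0 s_gt0 invf_lt1.
have c0' : 0 < c by rewrite subr_gt0; case/andP: s10.
have pc : p + c <= 1.
  by rewrite addrCA gerDl subr_le0 -(ler_pM2r s_gt0) mulVf ?gt_eqF.
have /andP[p_ge0 _] := p01.
have := lieb_concavity U0u U1u U2u Wu F1u F2u a0_ge0 a1_ge0 a2_ge0 b_ge0
  (fun i => powR_ge0 _ _) (fun i => powR_ge0 _ _) t01 HA (esym BE) L p_ge0 c0' pc.
rewrite (lieb_form U0 W (fun i => a0 i `^ p) (fun j => b j `^ c)).
(* The equality case: for [B = M^s] one has [M B^c = M^(1 + s - 1) = M^s]. *)
have cE U F a c' : unitary U -> unitary F -> (forall i, 0 <= c' i) ->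
    adj L *m spec U (fun i => a i `^ p) *m L = spec F c' ->
    \sum_i \sum_j a i `^ p * (c' j `^ s) `^ c * sqmod ((U *m L *m adj F) i j) =
    \sum_j c' j `^ s.
  move=> Uu Fu c'0 E.
  rewrite (lieb_form U F (fun i => a i `^ p) (fun j => (c' j `^ s) `^ c)).
  apply: eq_bigr => j _.
  rewrite tf_mul E (tf_spec_eigen _ _ Fu) -powRrM /c mulrBr mulr1 mulfV ?gt_eqF //.
  by rewrite mulrC mulr_powRB1.
rewrite (cE _ _ _ _ U1u F1u c1_ge0 H1) (cE _ _ _ _ U2u F2u c2_ge0 H2) -/T => le1.
(* At index [0], Young's inequality is applied to each pair of eigenvalues and summed with the
   doubly stochastic weights [sqmod ((F0 *m adj W) i j)]. Together with [le1] this reads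
   [T <= c T + S / s] for the sum [S] on the right of the claim, that is, [T <= S]. *)
have le2 : \sum_j b j `^ c *
      tf (spec U0 (fun i => a0 i `^ p)) (L *m (adj W *m delta_mx j (0 : 'I_1))) <=
      c * T + s^-1 * \sum_i c0 i `^ s.
  have Qu : unitary (F0 *m adj W) := unitary_mul F0u (unitary_adj Wu).
  have -> : c * T + s^-1 * \sum_i c0 i `^ s = \sum_j \sum_i
     (c * b j + s^-1 * c0 i `^ s) * sqmod ((F0 *m adj W) i j).
    rewrite -TE; under [RHS]eq_bigr do under eq_bigr do rewrite mulrDl.
    under [RHS]eq_bigr do rewrite big_split /= -mulr_sumr (unitary_col_sum _ Qu) mulr1.
    rewrite big_split /= -mulr_sumr; congr (_ + _); rewrite exchange_big mulr_sumr.
    by apply: eq_bigr => i _; rewrite -mulr_sumr (unitary_row_sum _ Qu) mulr1.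
  apply: ler_sum => j _; rewrite tf_mul H0 tf_spec mulr_sumr.
  apply: ler_sum => i _; rewrite big_ord1 mulmxA -colE [X in sqmod X]mxE mulrA.
  rewrite ler_wpM2r ?sqmod_ge0 //.
  have := young (powR_ge0 (c0 i) s) (b_ge0 j) s10.
  rewrite -/c -powRrM mulfV ?gt_eqF // powRr1 // mulrC => /le_trans; apply.
  by rewrite addrC.
have := le_trans le1 le2; rewrite -lerBlDl -{1}[T]mul1r -mulrBl.
have -> : 1 - c = s^-1 by rewrite /c; ring.
by rewrite ler_pM2l ?invr_gt0.
Qed.

Lemma trace_epstein :
  t * (\sum_i c1 i `^ s) + (1 - t) * (\sum_i c2 i `^ s) <= \sum_i c0 i `^ s.
Proof.
by have [|] := leP s 1; [exact: trace_epstein_le1|exact: trace_epstein_gt1].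
Qed.

End TraceEpstein.
End Epstein.

(** * Sums of smallest eigenvalues and majorization *)

Section KyFan.
Variable R : realType.
Local Notation C := R[i].

Definition incl m k (km : (k <= m)%N) : 'M[C]_(m, k) :=
  \matrix_(i, j) (i == widen_ord km j)%:R.

Lemma mul_incl m k p (km : (k <= m)%N) (X : 'M[C]_(p, m)) i j :
  (X *m incl km) i j = X i (widen_ord km j).
Proof.
rewrite mxE (bigD1 (widen_ord km j)) //= mxE eqxx mulr1 big1 ?addr0 // => l lj.
by rewrite mxE (negbTE lj) mulr0.
Qed.

Lemma adj_incl_mul m k p (km : (k <= m)%N) (X : 'M[C]_(m, p)) i j :
  (adj (incl km) *m X) i j = X (widen_ord km i) j.
Proof.
rewrite mxE (bigD1 (widen_ord km i)) //= adj_mxE mxE eqxx conjc1 mul1r.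
rewrite big1 ?addr0 // => l li.
by rewrite adj_mxE mxE (negbTE li) conjc0 mul0r.
Qed.

Lemma dg_incl m k (km : (k <= m)%N) (c : 'I_m -> R) :
  adj (incl km) *m dg c *m incl km = dg (c \o widen_ord km).
Proof.
by apply/matrixP => i j; rewrite mul_incl adj_incl_mul !dgE.
Qed.

Lemma herm_conj n m (U : 'M[C]_n) a (V : 'M[C]_(n, m)) :
  adj V *m spec U a *m V \is hermsymmx.
Proof.
apply/is_hermitianmxP; rewrite expr0 scale1r -adjE.
by rewrite (adjM (adj V *m _)) (adjM (adj V)) adjK spec_adj mulmxA.
Qed.

Lemma spec1 n (a : 'I_n -> R) : spec 1%:M a = dg a.
Proof. by rewrite !specE adjmx1 mul1mx mulmx1. Qed.

Lemma conj_eig_ge0 n m (U : 'M[C]_n) (F : 'M[C]_m) a c (L : 'M[C]_(n, m)) :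
  unitary F -> (forall i, 0 <= a i) -> adj L *m spec U a *m L = spec F c ->
  forall i, 0 <= c i.
Proof.
move=> Fu a0 E i; rewrite -(tf_spec_eigen c i Fu) -E -tf_mul.
exact: tf_spec_ge0.
Qed.

Section Sums.
Variables (n m : nat) (t p s : R) (U0 U1 U2 : 'M[C]_n) (F0 F1 F2 : 'M[C]_m).
Variables (a0 a1 a2 : 'I_n -> R) (c0 c1 c2 : 'I_m -> R) (K : 'M[C]_(n, m)).
Hypotheses (U0u : unitary U0) (U1u : unitary U1) (U2u : unitary U2)
  (F0u : unitary F0) (F1u : unitary F1) (F2u : unitary F2).
Hypotheses (a0_ge0 : forall i, 0 <= a0 i) (a1_ge0 : forall i, 0 <= a1 i)
  (a2_ge0 : forall i, 0 <= a2 i).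
Hypotheses (c1_nd : nondecr c1) (c2_nd : nondecr c2).
Hypothesis t01 : 0 <= t <= 1.
Hypothesis HA : spec U0 a0 = t%:C *: spec U1 a1 + (1 - t)%:C *: spec U2 a2.
Hypotheses
  (H0 : adj K *m spec U0 (fun i => a0 i `^ p) *m K = spec F0 c0)
  (H1 : adj K *m spec U1 (fun i => a1 i `^ p) *m K = spec F1 c1)
  (H2 : adj K *m spec U2 (fun i => a2 i `^ p) *m K = spec F2 c2).
Hypotheses (p01 : 0 <= p <= 1) (s_gt0 : 0 < s) (ps1 : p * s <= 1).

(* Compress to the span [V] of the first [k] eigenvectors of [spec F0 c0]: the
   compressed eigenvalues of the other two matrices can only increase. *)
Lemma ky_fan_concave k : (k <= m)%N ->
  \sum_(i < m | (i < k)%N) (t * c1 i `^ s + (1 - t) * c2 i `^ s) <=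
  \sum_(i < m | (i < k)%N) c0 i `^ s.
Proof.
move=> km; rewrite !(big_ord_narrow km).
pose V := adj F0 *m incl km.
have Vconj a : adj V *m spec F0 a *m V = dg (a \o widen_ord km).
  rewrite /V adjM adjK -dg_incl !specE !mulmxA.
  by rewrite -!(mulmxA _ F0 (adj F0)) (mul_adj F0u) !mulmx1.
have VV : adj V *m V = 1%:M.
  have := Vconj (fun=> 1); rewrite (spec_const _ F0u) mulmx1 => ->.
  by rewrite dg_const.
have L0 : adj (K *m V) *m spec U0 (fun i => a0 i `^ p) *m (K *m V) =
    spec 1%:M (c0 \o widen_ord km).
  by rewrite spec1 -Vconj -H0 adjM !mulmxA.
have compress U F a c : unitary F -> nondecr c ->
    adj K *m spec U (fun i => a i `^ p) *m K = spec F c ->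
    exists G b, [/\ unitary G,
      adj (K *m V) *m spec U (fun i => a i `^ p) *m (K *m V) = spec G b &
      forall j : 'I_k, 0 <= c (widen_ord km j) <= b j].
  move=> Fu nc E.
  have [G [b [Gu nb GE]]] := spectral_sorted (herm_conj F c V).
  exists G, b; split => //; first by rewrite -GE -E adjM !mulmxA.
  move=> j; have a_ge0 i : 0 <= a i `^ p by exact: powR_ge0.
  rewrite (conj_eig_ge0 Fu a_ge0 E) /=.
  apply: (@interlacing _ _ _ km V F G c b VV Fu Gu nc nb _ j) => x.
  by rewrite tf_mul GE.
have [G1 [b1 [G1u L1 cb1]]] := compress _ _ _ _ F1u c1_nd H1.
have [G2 [b2 [G2u L2 cb2]]] := compress _ _ _ _ F2u c2_nd H2.
have := trace_epstein U0u U1u U2u (unitary1 _ _) G1u G2u a0_ge0 a1_ge0 a2_ge0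
  t01 HA L0 L1 L2 p01 s_gt0 ps1.
apply: le_trans; rewrite big_split /= -!mulr_sumr.
have [t0 t1] : 0 <= t /\ 0 <= 1 - t by case/andP: t01; rewrite subr_ge0.
have le_pow (b : 'I_k -> R) (c : 'I_m -> R) :
    (forall j : 'I_k, 0 <= c (widen_ord km j) <= b j) ->
    \sum_(j < k) c (widen_ord km j) `^ s <= \sum_(j < k) b j `^ s.
  move=> cb; apply: ler_sum => j _; have /andP[cj0 cbj] := cb j.
  by apply: (ge0_ler_powR (ltW s_gt0)); rewrite ?nnegrE // (le_trans cj0).
by apply: lerD; apply: ler_wpM2l => //; exact: le_pow.
Qed.

End Sums.

(* Hardy, Littlewood and Polya: [y] is moved towards [x] by T-transforms,
   each of which decreases the number of indices where [x] and [y] differ. *)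
Lemma hlp_monotone n (G : ('I_n -> R) -> R) (x y : 'I_n -> R) :
  (forall u v, (forall i, 0 < u i) -> (forall i, u i <= v i) -> G u <= G v) ->
  (forall u i j, (forall i, 0 < u i) -> G (u \o tperm i j) = G u) ->
  (forall u v r, (forall i, 0 < u i) -> (forall i, 0 < v i) -> 0 <= r <= 1 ->
    r * G u + (1 - r) * G v <= G (fun i => r * u i + (1 - r) * v i)) ->
  (forall i, 0 < y i) -> nondecr x ->
  (forall k, (k <= n)%N -> \sum_(i < n | (i < k)%N) y i <= \sum_(i < n | (i < k)%N) x i) ->
  G y <= G x.
Proof.
move=> Gmono Gperm Gconc y0 nx.
have [m] := ubnP #|[pred i | x i != y i]|; elim: m y y0 => // m IH y y0.
rewrite ltnS => card_le S.
have [/forallP yx|] := boolP [forall j, y j <= x j]; first exact: Gmono.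
rewrite negb_forall => /existsP[j0]; rewrite -ltNge => j0P.
(* [j] is the first index where [y] exceeds [x]. Some earlier entry of [y] must lie strictly below
   that of [x], since otherwise the sums of the first [j + 1] entries would violate the
   hypothesis. *)
have [j xyj jmin] := @arg_minnP _ j0 (fun j => x j < y j) (fun j => j : nat) j0P.
have below (l : 'I_n) : (l < j)%N -> y l <= x l.
  by move=> lj; rewrite leNgt; apply/negP => /jmin; rewrite leqNgt lj.
have [i /andP[ij yxi]] : exists i : 'I_n, (i < j)%N && (y i < x i).
  apply/existsP; apply: contraLR xyj; rewrite negb_exists => /forallP H.
  rewrite -leNgt; have := S j.+1 (ltn_ord j).
  rewrite (bigD1 j) //= [leRHS](bigD1 j) //=.
  rewrite (eq_bigr x) ?lerD2r // => l /andP[]; rewrite ltnS leq_eqVlt.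
  case/orP => [/eqP/val_inj -> /eqP//|lj _].
  by apply/le_anti; rewrite below //=; have := H l; rewrite lj /= -leNgt.
have xij : x i <= x j by apply: nx; exact: ltnW.
have ij' : i != j by apply: contraTneq ij => ->; rewrite ltnn.
(* The largest amount that can be moved from [j] to [i] without overshooting [x] at either index, so
   that one of the two gaps closes. The result [y'] is a mixture of [y] and its transposition with
   weights [r] and [1 - r]. *)
pose d := Num.min (x i - y i) (y j - x j).
have d0 : 0 < d by rewrite lt_min !subr_gt0 yxi.
have dx : d <= x i - y i by rewrite ge_min lexx.
have dy : d <= y j - x j by rewrite ge_min lexx orbT.
have yij : 0 < y j - y i by lra.
pose r := 1 - d / (y j - y i).
have r01 : 0 <= r <= 1.
  have q0 : 0 <= d / (y j - y i) by rewrite divr_ge0 // ltW.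
  have q1 : d / (y j - y i) <= 1 by rewrite ler_pdivrMr // mul1r; lra.
  by rewrite /r; apply/andP; split; lra.
pose y' l := y l + d * ((l == i)%:R - (l == j)%:R).
have y'E : y' = (fun l => r * y l + (1 - r) * (y \o tperm i j) l).
  apply/funext => l; rewrite /y' /r /=; case: tpermP => [->|->|/eqP li /eqP lj].
  - by rewrite eqxx (negbTE ij') /=; field; rewrite gt_eqF.
  - by rewrite eqxx eq_sym (negbTE ij') /=; field; rewrite gt_eqF.
  - by rewrite (negbTE li) (negbTE lj) /=; field; rewrite gt_eqF.
have Gyy' : G y <= G y'.
  have yp0 l : 0 < (y \o tperm i j) l by exact: y0.
  apply: le_trans (_ : r * G y + (1 - r) * G (y \o tperm i j) <= _).
    by rewrite Gperm // -mulrDl addrC subrK mul1r.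
  by rewrite y'E; exact: Gconc.
apply: le_trans Gyy' (IH _ _ _ _).
- move=> l; have rl : 0 < r \/ 0 < 1 - r by lra.
  rewrite y'E; have := y0 l; have := y0 (tperm i j l); case/andP: r01 => r0 r1 /= p1 p2.
  case: rl => rp.
    by rewrite ltr_pwDl ?mulr_gt0 // mulr_ge0 ?subr_ge0 // ltW.
  by rewrite ltr_pwDr ?mulr_gt0 // mulr_ge0 // ltW.
- apply: leq_trans card_le; apply: proper_card; apply/properP; split.
    apply/fintype.subsetP => l; rewrite !inE /y'.
    have [->|li] := eqVneq l i; first by move=> _; rewrite gt_eqF.
    have [->|lj] := eqVneq l j; first by move=> _; rewrite lt_eqF.
    by rewrite subrr mulr0 addr0.
  have [dE|dE] : d = x i - y i \/ d = y j - x j.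
    by rewrite /d /Num.min; case: ifP; [left|right].
    exists i; rewrite !inE; first by rewrite gt_eqF.
    by rewrite negbK /y' eqxx (negbTE ij') subr0 mulr1 dE addrC subrK.
  exists j; rewrite !inE; first by rewrite lt_eqF.
  by rewrite negbK /y' eqxx [j == i]eq_sym (negbTE ij') sub0r mulrN1 dE opprB addrC subrK.
(* Only the sums with [i < k <= j] change, and they grow by [d]. The surplus of [x] over [y] at [i]
   pays for this, as [y <= x] at all indices below [j]. *)
- move=> k kn; rewrite big_split /= -mulr_sumr sumrB.
  have ind (l : 'I_n) : \sum_(h < n | (h < k)%N) (h == l)%:R = (l < k)%:R :> R.
    rewrite big_mkcond (bigD1 l) //= eqxx big1 ?addr0 => [|h hl].
      by case: ifP.
    by rewrite (negbTE hl) if_same.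
  rewrite !ind; have := S k kn.
  have [jk|kj] := ltnP j k; first by rewrite (ltn_trans ij jk) subrr mulr0 addr0.
  have [ik|ki] := ltnP i k; last by rewrite subr0 mulr0 addr0.
  move=> _; rewrite subr0 mulr1 -lerBrDl -sumrB (bigD1 i) //=.
  apply: le_trans dx _; rewrite lerDl; apply: sumr_ge0 => l /andP[lk _].
  by rewrite subr_ge0 below // (leq_trans lk).
Qed.

End KyFan.

(** * Anti-norms as functions of the eigenvalues *)

Section AntiNorm.
Variables (R : realType) (n : nat) (N : 'M[R[i]]_n -> R).
Hypothesis HN : symmetric_antinorm N.
Local Notation C := R[i].
Implicit Types x y : 'I_n -> R.

Lemma posdef_dg x : (forall i, 0 < x i) -> posdef (dg x).
Proof. by move=> x0; rewrite -spec1; apply/(posdef_spec _ (unitary1 _ n)). Qed.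

Lemma antinorm_spec (U : 'M[C]_n) x : unitary U -> (forall i, 0 < x i) ->
  N (spec U x) = N (dg x).
Proof.
move=> Uu x0; have /unitarymxE := unitary_adj Uu.
move=> /(antinorm_unitary HN)/(_ (posdef_dg x0)).
by rewrite -adjE adjK -specE.
Qed.

Lemma antinorm_dg_perm x (s : 'S_n) : (forall i, 0 < x i) ->
  N (dg (x \o s)) = N (dg x).
Proof.
move=> x0; rewrite -[in RHS]spec1 -(spec_perm _ _ s) mulmx1.
by rewrite (antinorm_spec (unitary_perm_mx _ s)) // => i; exact: x0.
Qed.

Lemma antinorm_dg_concave x y (t : R) :
  (forall i, 0 < x i) -> (forall i, 0 < y i) -> 0 <= t <= 1 ->
  t * N (dg x) + (1 - t) * N (dg y) <= N (dg (fun i => t * x i + (1 - t) * y i)).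
Proof.
move=> x0 y0 /andP[t0 t1].
have [->|tn0] := eqVneq t 0.
  rewrite mul0r add0r subr0 mul1r (@eq_dg _ _ _ y) // => i.
  by rewrite mul0r add0r mul1r.
have [->|tn1] := eqVneq t 1.
  rewrite subrr mul0r addr0 mul1r (@eq_dg _ _ _ x) // => i.
  by rewrite mul0r addr0 mul1r.
have tp : 0 < t by rewrite lt0r tn0.
have tp' : 0 < 1 - t by rewrite subr_gt0 lt_neqAle tn1.
have px := posdef_dg x0; have py := posdef_dg y0.
rewrite -(antinorm_homogeneous HN tp px) -(antinorm_homogeneous HN tp' py).
rewrite -dgD -!dgZ; apply: (antinorm_superadditive HN); rewrite dgZ;
  by apply: posdef_dg => i; rewrite mulr_gt0.
Qed.

(** Superadditivity needs a positive definite difference, so [y] is first scaled by [1 + e];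
    homogeneity makes this cost [e N (dg y)], which tends to [0]. *)
Lemma antinorm_dg_mono x y : (forall i, 0 < x i) -> (forall i, x i <= y i) ->
  N (dg x) <= N (dg y).
Proof.
move=> x0 xy; have y0 i : 0 < y i := lt_le_trans (x0 i) (xy i).
apply: (@ge0_le_add_geom _ _ _ (N (dg y))) => k.
set e : R := 2^-1 ^+ k; have e0 : 0 < e by rewrite exprn_gt0.
have -> : N (dg y) + N (dg y) / 2 ^+ k = N (dg (fun i => (1 + e) * y i)).
  rewrite -dgZ (antinorm_homogeneous HN) ?addr_gt0 //; last exact: posdef_dg.
  by rewrite /e exprVn; ring.
have zy i : 0 < y i - x i + e * y i.
  by rewrite ltr_wpDl ?subr_ge0 // mulr_gt0.
rewrite (@eq_dg _ _ (fun i => (1 + e) * y i) (fun i => x i + (y i - x i + e * y i))); last first.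
  by move=> i; ring.
rewrite -dgD; apply: le_trans (antinorm_superadditive HN _ _) => //.
- by rewrite lerDl; apply: (antinorm_ge0 HN); exact: posdef_dg.
- exact: posdef_dg.
- exact: posdef_dg.
Qed.

Lemma antinorm_dg_hlp x y : (forall i, 0 < y i) -> nondecr x ->
  (forall k, (k <= n)%N ->
    \sum_(i < n | (i < k)%N) y i <= \sum_(i < n | (i < k)%N) x i) ->
  N (dg y) <= N (dg x).
Proof.
move=> y0 nx S; apply: (hlp_monotone (G := N \o (@dg R n))) y0 nx S => /=.
- by move=> u v; exact: antinorm_dg_mono.
- by move=> u i j; exact: antinorm_dg_perm.
- by move=> u v r; exact: antinorm_dg_concave.
Qed.

(** The extended anti-norm as a function of the eigenvalues of its argument; see
    [antinorm_ext_spec]. *)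
Definition ext_dg x : R := lim (N (dg (fun i => x i + e)) @[e --> 0^'+]).

Lemma ext_dg_cvg x : (forall i, 0 <= x i) ->
  N (dg (fun i => x i + e)) @[e --> 0^'+] --> ext_dg x.
Proof.
move=> x0; apply: nondecreasing_at_right_is_cvgr.
  near=> b; move=> e f; rewrite !in_itv /= => /andP[e0 _] /andP[f0 _] ef.
  by apply: antinorm_dg_mono => i; rewrite ?lerD2l // ltr_wpDl.
near=> b; exists 0 => _ [e /= + <-]; rewrite in_itv /= => /andP[e0 _].
by apply: (antinorm_ge0 HN); apply: posdef_dg => i; rewrite ltr_wpDl.
Unshelve. all: by end_near. Qed.

Lemma antinorm_ext_spec (U : 'M[C]_n) x : unitary U -> (forall i, 0 <= x i) ->
  antinorm_ext N (spec U x) = ext_dg x.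
Proof.
move=> Uu x0; apply: cvg_lim => //; apply: cvg_trans (ext_dg_cvg x0).
apply: near_eq_cvg; near=> e; have e0 : 0 < e by [].
rewrite -(spec_const e Uu) specD antinorm_spec // => i.
by rewrite ltr_wpDl.
Unshelve. all: by end_near. Qed.

Lemma ext_dg_le x y : (forall i, 0 <= x i) -> (forall i, 0 <= y i) ->
  (forall e, 0 < e -> N (dg (fun i => x i + e)) <= N (dg (fun i => y i + e))) ->
  ext_dg x <= ext_dg y.
Proof.
move=> x0 y0 H; apply: ler_cvg_to (ext_dg_cvg x0) (ext_dg_cvg y0) _.
by near=> e; apply: H.
Unshelve. all: by end_near. Qed.

Lemma ext_dg_mono x y : (forall i, 0 <= x i) -> (forall i, x i <= y i) ->
  ext_dg x <= ext_dg y.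
Proof.
move=> x0 xy; apply: ext_dg_le => // [i|e e0]; first exact: le_trans (xy i).
by apply: antinorm_dg_mono => i; rewrite ?lerD2r // ltr_wpDl.
Qed.

Lemma ext_dg_le_shift x e : (forall i, 0 <= x i) -> 0 < e ->
  ext_dg x <= N (dg (fun i => x i + e)).
Proof.
move=> x0 e0; apply: limr_le; first exact: (ext_dg_cvg x0).
near=> f; apply: antinorm_dg_mono => i.
  by rewrite ltr_wpDl.
by rewrite lerD2l ltW //; near: f; exact: nbhs_right_lt.
Unshelve. all: by end_near. Qed.

(** If [m > 0] bounds the entries from below, then [x + e m <= (1 + e) x], whose anti-norm is
    [(1 + e) N (dg x)]. *)
Lemma ext_dg_pos x : (forall i, 0 < x i) -> ext_dg x = N (dg x).
Proof.
move=> x0; have x0' i : 0 <= x i := ltW (x0 i); apply/le_anti/andP; split.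
  have [m m0 mx] : exists2 m : R, 0 < m & forall i, m <= x i.
    case: n x x0 {x0'} => [|n'] x x0; first by exists 1 => // -[].
    have [i _ /= imin] := @Order.TotalTheory.arg_minP _ _ _ ord0 xpredT x isT.
    by exists (x i) => // j; exact: imin.
  apply: (@ge0_le_add_geom _ _ _ (N (dg x))) => k.
  set e : R := 2^-1 ^+ k; have e0 : 0 < e by rewrite exprn_gt0.
  apply: le_trans (ext_dg_le_shift x0' (mulr_gt0 e0 m0)) _.
  have -> : N (dg x) + N (dg x) / 2 ^+ k = N (dg (fun i => (1 + e) * x i)).
    rewrite -dgZ (antinorm_homogeneous HN) ?addr_gt0 //; last exact: posdef_dg.
    by rewrite /e exprVn; ring.
  apply: antinorm_dg_mono => i; first by rewrite addr_gt0 // mulr_gt0.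
  by rewrite mulrDl mul1r lerD2l ler_wpM2l // ltW.
apply: limr_ge; first exact: (ext_dg_cvg x0').
near=> e; apply: antinorm_dg_mono => // i; by rewrite lerDl ltW.
Unshelve. all: by end_near. Qed.

Lemma ext_dg_concave x y (t : R) :
  (forall i, 0 <= x i) -> (forall i, 0 <= y i) -> 0 <= t <= 1 ->
  t * ext_dg x + (1 - t) * ext_dg y <= ext_dg (fun i => t * x i + (1 - t) * y i).
Proof.
move=> x0 y0 t01; have /andP[t0 t1] := t01.
have z0 i : 0 <= t * x i + (1 - t) * y i.
  by rewrite addr_ge0 // mulr_ge0 // subr_ge0.
have cv : t * N (dg (fun i => x i + e)) + (1 - t) * N (dg (fun i => y i + e))
    @[e --> 0^'+] --> t * ext_dg x + (1 - t) * ext_dg y.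
  by apply: cvgD; apply: cvgMr; exact: ext_dg_cvg.
apply: ler_cvg_to cv (ext_dg_cvg z0) _; near=> e.
rewrite (_ : dg (fun i => t * x i + (1 - t) * y i + e) =
  dg (fun i => t * (x i + e) + (1 - t) * (y i + e))); last first.
  by apply: eq_dg => i; ring.
by apply: antinorm_dg_concave => // i; rewrite ltr_wpDl.
Unshelve. all: by end_near. Qed.

Lemma ext_dg_hlp x y : (forall i, 0 <= x i) -> (forall i, 0 <= y i) -> nondecr x ->
  (forall k, (k <= n)%N ->
    \sum_(i < n | (i < k)%N) y i <= \sum_(i < n | (i < k)%N) x i) ->
  ext_dg y <= ext_dg x.
Proof.
move=> x0 y0 nx S; apply: ext_dg_le => // e e0; apply: antinorm_dg_hlp => //.
- by move=> i; rewrite ltr_wpDl.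
- by move=> i j ij; rewrite lerD2r nx.
- by move=> k kn; rewrite !big_split lerD2r S.
Qed.

(** * Concavity in one matrix variable *)

Section OneVariable.
Variables (m : nat) (t p s : R) (U0 U1 U2 : 'M[C]_m) (F0 F1 F2 : 'M[C]_n).
Variables (a0 a1 a2 : 'I_m -> R) (c0 c1 c2 : 'I_n -> R) (K : 'M[C]_(m, n)).
Hypotheses (U0u : unitary U0) (U1u : unitary U1) (U2u : unitary U2)
  (F0u : unitary F0) (F1u : unitary F1) (F2u : unitary F2).
Hypotheses (a0_ge0 : forall i, 0 <= a0 i) (a1_ge0 : forall i, 0 <= a1 i)
  (a2_ge0 : forall i, 0 <= a2 i).
Hypotheses (c0_nd : nondecr c0) (c1_nd : nondecr c1) (c2_nd : nondecr c2).
Hypothesis t01 : 0 <= t <= 1.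
Hypothesis HA : spec U0 a0 = t%:C *: spec U1 a1 + (1 - t)%:C *: spec U2 a2.
Hypotheses
  (H0 : adj K *m spec U0 (fun i => a0 i `^ p) *m K = spec F0 c0)
  (H1 : adj K *m spec U1 (fun i => a1 i `^ p) *m K = spec F1 c1)
  (H2 : adj K *m spec U2 (fun i => a2 i `^ p) *m K = spec F2 c2).
Hypotheses (p01 : 0 <= p <= 1) (s_gt0 : 0 < s) (ps1 : p * s <= 1).

(** Concavity of [ext_dg] merges the two terms on the left; the merged vector is then compared with
    [c0^s] through [ext_dg_hlp], whose partial sums are controlled by [ky_fan_concave]. *)
Lemma one_variable_concave :
  t * ext_dg (fun i => c1 i `^ s) + (1 - t) * ext_dg (fun i => c2 i `^ s) <=
  ext_dg (fun i => c0 i `^ s).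
Proof.
have pow0 (c : 'I_n -> R) i : 0 <= c i `^ s by exact: powR_ge0.
apply: le_trans (ext_dg_concave (pow0 c1) (pow0 c2) t01) _.
have [t0 t1] : 0 <= t /\ 0 <= 1 - t by case/andP: t01; rewrite subr_ge0.
apply: ext_dg_hlp.
- by move=> i; exact: pow0.
- by move=> i; apply: addr_ge0; apply: mulr_ge0.
- move=> i j ij; have ap i' : 0 <= a0 i' `^ p by exact: powR_ge0.
  have c0_ge0 := conj_eig_ge0 F0u ap H0.
  by apply: (ge0_ler_powR (ltW s_gt0)); rewrite ?nnegrE // c0_nd.
- move=> k kn.
  exact: (ky_fan_concave U0u U1u U2u F0u F1u F2u a0_ge0 a1_ge0 a2_ge0 c1_nd c2_nd
    t01 HA H0 H1 H2 p01 s_gt0 ps1 kn).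
Qed.

End OneVariable.
End AntiNorm.

(** * Hoelder's inequality and joint concavity *)

Section Hoelder.
Variables (R : realType) (n : nat) (N : 'M[R[i]]_n -> R).
Hypothesis HN : symmetric_antinorm N.
Hypothesis HH : antinorm_hoelder N.
Local Notation C := R[i].

Lemma powR_half (x s : R) : 0 <= x -> (x `^ 2^-1) `^ (2 * s) = x `^ s.
Proof. by move=> x0; rewrite -powRrM mulKf. Qed.

Lemma mul_powR_half (x s : R) : 0 < x -> x `^ (s / 2) * x `^ (s / 2) = x `^ s.
Proof. by move=> x0; rewrite -powRD -?splitr // (gt_eqF x0) implybT. Qed.

Lemma mxabs_spec (U : 'M[C]_n) x : unitary U -> (forall i, 0 <= x i) ->
  mxabs (spec U x) = spec U x.
Proof.
move=> Uu x0; rewrite /mxabs -adjE spec_adj (specM _ _ Uu) (mxpow_spec _ _ Uu).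
by apply: eq_spec => i; rewrite powR12_sqrt ?mulr_ge0 // -expr2 sqrtr_sqr ger0_norm.
Qed.

Lemma spec_unitmx (U : 'M[C]_n) x : unitary U -> (forall i, 0 < x i) ->
  spec U x \in unitmx.
Proof.
move=> Uu x0.
have E : spec U x *m spec U (fun i => (x i)^-1) = 1%:M.
  rewrite (specM _ _ Uu) -[RHS](spec_const 1 Uu); apply: eq_spec => i.
  by rewrite mulfV ?gt_eqF.
exact: (mulmx1_unit E).1.
Qed.

Lemma spec_half_sq (U : 'M[C]_n) x r : unitary U -> (forall i, 0 < x i) ->
  spec U (fun i => x i `^ (r / 2)) *m spec U (fun i => x i `^ (r / 2)) =
  spec U (fun i => x i `^ r).
Proof.
by move=> Uu x0; rewrite (specM _ _ Uu); apply: eq_spec => i; exact: mul_powR_half.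
Qed.

Lemma gram_spec_mul (U X : 'M[C]_n) x r : unitary U -> (forall i, 0 < x i) ->
  adj (spec U (fun i => x i `^ (r / 2)) *m X) *m
    (spec U (fun i => x i `^ (r / 2)) *m X) =
  adj X *m spec U (fun i => x i `^ r) *m X.
Proof.
move=> Uu x0; rewrite -(spec_half_sq r Uu x0) adjM spec_adj.
by rewrite !mulmxA.
Qed.

Lemma gram_mul_spec (U X : 'M[C]_n) x r : unitary U -> (forall i, 0 < x i) ->
  X *m spec U (fun i => x i `^ (r / 2)) *m
    adj (X *m spec U (fun i => x i `^ (r / 2))) =
  X *m spec U (fun i => x i `^ r) *m adj X.
Proof.
move=> Uu x0; rewrite -(spec_half_sq r Uu x0) adjM spec_adj.
by rewrite !mulmxA.
Qed.

Lemma gram_eig_gt0 (M U : 'M[C]_n) x : M \in unitmx -> unitary U ->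
  adj M *m M = spec U x -> forall i, 0 < x i.
Proof.
move=> Mu Uu E i; rewrite -(tf_spec_eigen x i Uu) -E tf_gram.
apply: tf1_gt0; have := eigvec_neq0 i Uu; apply: contra_neq => Mv0.
by rewrite -[LHS](mulKmx Mu) Mv0 mulmx0.
Qed.

Lemma adj_unitmx (M : 'M[C]_n) : M \in unitmx -> adj M \in unitmx.
Proof.
move=> Mu; have E : adj M *m adj (invmx M) = 1%:M.
  by rewrite -adjM mulVmx // adjmx1.
exact: (mulmx1_unit E).1.
Qed.

Lemma ler_tf_spec_pointwise (U : 'M[C]_n) x y (v : 'cV[C]_n) :
  (forall i, x i <= y i) -> tf (spec U x) v <= tf (spec U y) v.
Proof.
move=> xy; rewrite !tf_spec; apply: ler_sum => i _; apply: ler_sum => j _.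
by rewrite ler_wpM2r ?sqmod_ge0.
Qed.

(** Raising the product bound to the power [2 s] gives [c <= a^(s/s1) b^(s/s2)] with exponents of
    sum [1], to which Young's inequality applies. *)
Lemma hoelder_young (a b c s s1 s2 : R) : 0 < s -> 0 < s1 -> 0 < s2 ->
  s^-1 = s1^-1 + s2^-1 -> 0 <= a -> 0 <= b -> 0 <= c ->
  c `^ (2 * s)^-1 <= a `^ (2 * s1)^-1 * b `^ (2 * s2)^-1 ->
  c <= s / s1 * a + s / s2 * b.
Proof.
move=> s0 s10 s20 E a0 b0 c0 H.
have ss0 : 0 < s / s1 by rewrite divr_gt0.
have ss : s / s2 = 1 - s / s1.
  have -> : s2^-1 = s^-1 - s1^-1 by rewrite E addrC addKr.
  by rewrite mulrBr mulfV ?gt_eqF.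
have ss1 : s / s1 < 1 by rewrite -subr_gt0 -ss divr_gt0.
have s2p : 0 <= 2 * s by rewrite mulr_ge0 // ltW.
rewrite ss; apply: le_trans (young a0 b0 _); last by rewrite ss0.
have := ge0_ler_powR s2p (powR_ge0 _ _) _ H.
rewrite nnegrE mulr_ge0 ?powR_ge0 // => /(_ isT).
rewrite powRM ?powR_ge0 // -!powRrM mulVf ?mulf_neq0 ?pnatr_eq0 ?gt_eqF // powRr1 //.
have e1 (u : R) : 0 < u -> (2 * u)^-1 * (2 * s) = s / u.
  by move=> u0; field; rewrite gt_eqF.
by rewrite (e1 _ s10) (e1 _ s20) ss.
Qed.

Lemma hoelder_spec (U V Q : 'M[C]_n) w y k (s s1 s2 : R) :
  0 < s -> 0 < s1 -> 0 < s2 -> s^-1 = s1^-1 + s2^-1 ->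
  unitary U -> unitary V -> unitary Q ->
  (forall i, 0 < w i) -> (forall i, 0 < y i) -> (forall i, 0 < k i) ->
  adj (spec U w *m spec V y) *m (spec U w *m spec V y) = spec Q k ->
  N (dg (fun i => k i `^ s)) `^ (2 * s)^-1 <=
  N (dg (fun i => w i `^ (2 * s1))) `^ (2 * s1)^-1 *
  N (dg (fun i => y i `^ (2 * s2))) `^ (2 * s2)^-1.
Proof.
move=> s0 s10 s20 sE Uu Vu Qu w0 y0 k0 GE.
have Up : posdef (spec U w) by apply/(posdef_spec _ Uu).
have Vp : posdef (spec V y) by apply/(posdef_spec _ Vu).
have r0 (u : R) : 0 < u -> 0 < 2 * u by move=> u0; rewrite mulr_gt0.
have rE : (2 * s)^-1 = (2 * s1)^-1 + (2 * s2)^-1 by rewrite !invfM sE mulrDr.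
have pow0 (u : R) x : (forall i : 'I_n, 0 < x i) -> forall i, 0 < x i `^ u.
  by move=> x0 i; exact: powR_gt0.
rewrite -(antinorm_spec HN Qu (pow0 s _ k0)) -(antinorm_spec HN Uu (pow0 _ _ w0)).
rewrite -(antinorm_spec HN Vu (pow0 _ _ y0)).
rewrite -(mxpow_spec (2 * s1) w Uu) -(mxpow_spec (2 * s2) y Vu).
have absE x (W : 'M[C]_n) : unitary W -> (forall i, 0 < x i) ->
    spec W x = mxabs (spec W x).
  by move=> Wu x0; rewrite mxabs_spec // => i; exact: ltW.
have -> : spec Q (fun i => k i `^ s) = mxpow (mxabs (spec U w *m spec V y)) (2 * s).
  rewrite /mxabs -adjE GE (mxpow_spec _ _ Qu) (mxpow_spec _ _ Qu).
  by apply: eq_spec => i; rewrite powR_half // ltW.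
have := HH Up Vp (r0 _ s0) (r0 _ s10) (r0 _ s20) rE.
by rewrite -(absE w U Uu w0) -(absE y V Vu y0).
Qed.

(* Hoelder's inequality for a singular left factor; the normalisation [r = 2 s]
   turns [|X|^r] into [(X^* X)^s]. *)
Lemma hoelder_ext (S T U V W : 'M[C]_n) x y z (s s1 s2 : R) :
  0 < s -> 0 < s1 -> 0 < s2 -> s^-1 = s1^-1 + s2^-1 ->
  T \in unitmx -> unitary U -> unitary V -> unitary W -> nondecr z ->
  adj S *m S = spec U x -> T *m adj T = spec V y ->
  adj (S *m T) *m (S *m T) = spec W z ->
  ext_dg N (fun i => z i `^ s) <=
  s / s1 * ext_dg N (fun i => x i `^ s1) + s / s2 * ext_dg N (fun i => y i `^ s2).
Proof.
move=> s0 s10 s20 sE Tu Uu Vu Wu nz xE yE zE.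
have x0 := gram_eig_ge0 Uu xE.
have z0 := gram_eig_ge0 Wu zE.
have y0 : forall i, 0 < y i.
  by apply: (gram_eig_gt0 (adj_unitmx Tu) Vu); rewrite adjK.
have ys0 i : 0 < y i `^ s2 by rewrite powR_gt0.
have xs0 i : 0 <= x i `^ s1 by exact: powR_ge0.
rewrite [ext_dg _ (fun i => y i `^ s2)]ext_dg_pos //.
set b := N (dg (fun i => y i `^ s2)).
suff key e : 0 < e -> ext_dg N (fun i => z i `^ s) <=
    s / s1 * N (dg (fun i => x i `^ s1 + e)) + s / s2 * b.
  have cv : s / s1 * N (dg (fun i => x i `^ s1 + e)) + s / s2 * b @[e --> 0^'+] -->
      s / s1 * ext_dg N (fun i => x i `^ s1) + s / s2 * b.
    apply: cvgD; last exact: cvg_cst.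
    by apply: cvgMr; exact: ext_dg_cvg.
  rewrite -(cvg_lim _ cv) //; apply: limr_ge; first by apply/cvg_ex; eexists; exact: cv.
  by near=> e; exact: key.
move=> e0; pose w i := x i `^ s1 + e.
have w0 i : 0 < w i by rewrite ltr_wpDl.
have wp0 r i : 0 < w i `^ r by exact: powR_gt0.
have yp0 r i : 0 < y i `^ r by exact: powR_gt0.
(* Positive definite stand-ins for the factors: [Se^(2 s1)] has eigenvalues [w], so [Se^2] dominates
   [adj S S], and [H] is the square root of [T adj T]. *)
pose Se := spec U (fun i => w i `^ (s1^-1 / 2)).
pose H := spec V (fun i => y i `^ 2^-1).
have Hinv : H *m spec V (fun i => y i `^ - 2^-1) = 1%:M.
  rewrite (specM _ _ Vu) -[RHS](spec_const 1 Vu); apply: eq_spec => i.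
  by rewrite powRN mulfV // gt_eqF.
have SHu : Se *m H \in unitmx by rewrite unitmx_mul !spec_unitmx.
have Gh : adj (Se *m H) *m (Se *m H) \is hermsymmx.
  apply/is_hermitianmxP; rewrite expr0 scale1r -adjE.
  by rewrite (adjM (adj _)) adjK.
have [Q [k [Qu nk GE]]] := spectral_sorted Gh.
have k0 := gram_eig_gt0 SHu Qu GE.
have k0' i : 0 <= k i := ltW (k0 i).
have ks0 i : 0 < k i `^ s by rewrite powR_gt0.
(* The unitary part of the polar decomposition [T = H V']. Hence the Gram matrices of [Se T] and
   [Se H] share the eigenvalues [k], and Weyl monotonicity gives [z <= k]. *)
pose V' := spec V (fun i => y i `^ - 2^-1) *m T.
have V'u : unitary V'.
  rewrite /unitary /V' (adjM (spec V _) T) spec_adj mulmxA -(mulmxA _ T) yE.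
  rewrite (specM _ _ Vu) (specM _ _ Vu) -[RHS](spec_const 1 Vu); apply: eq_spec => i.
  rewrite powRN; have := mul_powR_half 1 (y0 i); rewrite powRr1 ?(ltW (y0 i)) // mul1r.
  by move=> {2}<-; field; rewrite gt_eqF.
have HV' : H *m V' = T by rewrite /V' mulmxA Hinv mul1mx.
have QE : spec (Q *m V') k = adj T *m spec U (fun i => w i `^ s1^-1) *m T.
  rewrite -spec_conj -GE; transitivity (adj (H *m V') *m (Se *m Se) *m (H *m V')).
    by rewrite (adjM H V') (adjM Se H) /Se !spec_adj !mulmxA.
  rewrite HV' (specM _ _ Uu); congr (_ *m _ *m _); apply: eq_spec => i.
  exact: mul_powR_half.
have zk : forall i, z i <= k i.
  apply: (weyl_mono Wu (unitary_mul Qu V'u) nz nk) => v.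
  rewrite -zE QE adjM !mulmxA -(mulmxA _ _ S) xE -!tf_mul.
  apply: ler_tf_spec_pointwise => i.
  rewrite -[leLHS](powRr1 (x0 i)) -(mulfV (lt0r_neq0 s10)) powRrM.
  apply: ge0_ler_powR; rewrite ?nnegrE ?invr_ge0 ?(ltW s10) ?xs0 ?(ltW (w0 i)) //.
  by rewrite /w lerDl ltW.
apply: le_trans (_ : ext_dg N (fun i => k i `^ s) <= _).
  apply: ext_dg_mono => // [i|i]; first exact: powR_ge0.
  by apply: ge0_ler_powR; rewrite ?nnegrE ?(ltW s0) ?z0 ?k0'.
rewrite ext_dg_pos //.
apply: (hoelder_young s0 s10 s20 sE).
- by apply: (antinorm_ge0 HN); exact: posdef_dg.
- by apply: (antinorm_ge0 HN); exact: posdef_dg.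
- by apply: (antinorm_ge0 HN); exact: posdef_dg.
have -> : dg w = dg (fun i => (w i `^ (s1^-1 / 2)) `^ (2 * s1)).
  apply: eq_dg => i; rewrite -powRrM mulrA divfK // mulVf ?gt_eqF //.
  by rewrite powRr1 // ltW.
have -> : b = N (dg (fun i => (y i `^ 2^-1) `^ (2 * s2))).
  by congr (N _); apply: eq_dg => i; rewrite powR_half // ltW.
exact: (hoelder_spec s0 s10 s20 sE Uu Vu Qu _ _ k0 GE).
Unshelve. all: by end_near.
Qed.

End Hoelder.

(** * Joint concavity in spectral data *)

Section JointConcavity.
Variables (R : realType) (n : nat) (N : 'M[R[i]]_n -> R).
Hypothesis HN : symmetric_antinorm N.
Hypothesis HH : antinorm_hoelder N.
Local Notation C := R[i].
Implicit Types x y : 'I_n -> R.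

Lemma weighted_bound (t u v f1 f2 x1 x2 y1 y2 g : R) :
  0 <= t -> 0 <= 1 - t -> 0 <= u -> 0 <= v -> u + v = 1 ->
  f1 <= u * x1 + v * y1 -> f2 <= u * x2 + v * y2 ->
  t * x1 + (1 - t) * x2 <= g -> t * y1 + (1 - t) * y2 <= g ->
  t * f1 + (1 - t) * f2 <= g.
Proof.
move=> t0 t1 u0 v0 uv /(ler_wpM2l t0) h1 /(ler_wpM2l t1) h2.
move=> /(ler_wpM2l u0) hx /(ler_wpM2l v0) hy.
have -> : g = u * g + v * g by rewrite -mulrDl uv mul1r.
by apply: le_trans (lerD h1 h2) _; apply: le_trans (lerD hx hy); lra.
Qed.

Section Triple.
Variables (t p q s : R) (K U0 U1 U2 V0 V1 V2 W0 W1 W2 : 'M[C]_n).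
Variables (a0 a1 a2 b0 b1 b2 c0 c1 c2 : 'I_n -> R).
Hypotheses (U0u : unitary U0) (U1u : unitary U1) (U2u : unitary U2)
  (V0u : unitary V0) (V1u : unitary V1) (V2u : unitary V2)
  (W0u : unitary W0) (W1u : unitary W1) (W2u : unitary W2).
Hypotheses (a0_gt0 : forall i, 0 < a0 i) (a1_gt0 : forall i, 0 < a1 i)
  (a2_gt0 : forall i, 0 < a2 i).
Hypotheses (b0_gt0 : forall i, 0 < b0 i) (b1_gt0 : forall i, 0 < b1 i)
  (b2_gt0 : forall i, 0 < b2 i).
Hypotheses (c0_nd : nondecr c0) (c1_nd : nondecr c1) (c2_nd : nondecr c2).
Hypothesis t01 : 0 <= t <= 1.
Hypothesis HA : spec U0 a0 = t%:C *: spec U1 a1 + (1 - t)%:C *: spec U2 a2.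
Hypothesis HB : spec V0 b0 = t%:C *: spec V1 b1 + (1 - t)%:C *: spec V2 b2.

(** This is [A^(p/2) K B^(q/2)]; its Gram matrix is the matrix whose power [s] enters the
    functional. *)
Definition factor (U V : 'M[C]_n) a b : 'M[C]_n :=
  spec U (fun i => a i `^ (p / 2)) *m K *m spec V (fun i => b i `^ (q / 2)).

Hypotheses
  (H0 : adj (factor U0 V0 a0 b0) *m factor U0 V0 a0 b0 = spec W0 c0)
  (H1 : adj (factor U1 V1 a1 b1) *m factor U1 V1 a1 b1 = spec W1 c1)
  (H2 : adj (factor U2 V2 a2 b2) *m factor U2 V2 a2 b2 = spec W2 c2).
Hypotheses (p01 : 0 <= p <= 1) (q01 : 0 <= q <= 1) (s_gt0 : 0 < s)
  (pqs : (p + q) * s <= 1).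

Let a0_ge0 i : 0 <= a0 i. Proof. exact: ltW. Qed.
Let a1_ge0 i : 0 <= a1 i. Proof. exact: ltW. Qed.
Let a2_ge0 i : 0 <= a2 i. Proof. exact: ltW. Qed.
Let b0_ge0 i : 0 <= b0 i. Proof. exact: ltW. Qed.
Let b1_ge0 i : 0 <= b1 i. Proof. exact: ltW. Qed.
Let b2_ge0 i : 0 <= b2 i. Proof. exact: ltW. Qed.

Let goal := t * ext_dg N (fun i => c1 i `^ s) + (1 - t) * ext_dg N (fun i => c2 i `^ s)
  <= ext_dg N (fun i => c0 i `^ s).

Lemma spec_powR0 (U : 'M[C]_n) x : unitary U -> spec U (fun i => x i `^ 0) = 1%:M.
Proof.
by move=> Uu; rewrite -[RHS](spec_const 1 Uu); apply: eq_spec => i; rewrite powRr0.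
Qed.

Lemma concave_q0 : q = 0 -> goal.
Proof.
move=> q0.
have E U V a b W c : unitary U -> unitary V -> (forall i, 0 < a i) ->
    adj (factor U V a b) *m factor U V a b = spec W c ->
    adj K *m spec U (fun i => a i `^ p) *m K = spec W c.
  move=> Uu Vu a_gt0; rewrite /factor q0 mul0r (spec_powR0 _ Vu) mulmx1 => <-.
  by rewrite (gram_spec_mul K p Uu a_gt0).
apply: (one_variable_concave HN U0u U1u U2u W0u W1u W2u a0_ge0 a1_ge0 a2_ge0
  c0_nd c1_nd c2_nd t01 HA (E _ _ _ _ _ _ U0u V0u a0_gt0 H0)
  (E _ _ _ _ _ _ U1u V1u a1_gt0 H1) (E _ _ _ _ _ _ U2u V2u a2_gt0 H2) p01 s_gt0).
by move: pqs; rewrite q0 addr0.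
Qed.

(** Here the matrix is [adj M M] with [M = K B^(q/2)]. It has the same eigenvalues as
    [M adj M = K B^q adj K], which is of the one-variable form with [adj K] in place of [K]. *)
Lemma concave_p0 : p = 0 -> goal.
Proof.
move=> p0.
have E U V a b W c : unitary U -> unitary V -> unitary W -> (forall i, 0 < b i) ->
    nondecr c -> adj (factor U V a b) *m factor U V a b = spec W c ->
    exists2 G, unitary G &
      adj (adj K) *m spec V (fun i => b i `^ q) *m adj K = spec G c.
  move=> Uu Vu Wu b_gt0 nc; rewrite /factor p0 mul0r (spec_powR0 _ Uu) mul1mx => E.
  have [G [d [Gu nd GE]]] := spectral_sorted (herm_conj V (fun i => b i `^ q) (adj K)).
  exists G => //; rewrite GE; apply: eq_spec => i.
  have E' : (K *m spec V (fun i => b i `^ (q / 2))) *m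
      adj (K *m spec V (fun i => b i `^ (q / 2))) = spec G d.
    by rewrite -GE adjK (gram_mul_spec K q Vu b_gt0).
  by rewrite (gram_eig_eq Wu Gu nc nd E E').
have [G0 G0u E0] := E _ _ _ _ _ _ U0u V0u W0u b0_gt0 c0_nd H0.
have [G1 G1u E1] := E _ _ _ _ _ _ U1u V1u W1u b1_gt0 c1_nd H1.
have [G2 G2u E2] := E _ _ _ _ _ _ U2u V2u W2u b2_gt0 c2_nd H2.
apply: (one_variable_concave HN V0u V1u V2u G0u G1u G2u b0_ge0 b1_ge0 b2_ge0
  c0_nd c1_nd c2_nd t01 HB E0 E1 E2 q01 s_gt0).
by move: pqs; rewrite p0 add0r.
Qed.

(* With [1/s = 1/s1 + 1/s2], Hoelder and Young bound the functional at every
   [(A, B)] by [s/s1 N((L' A^p L)^s1) + s/s2 N((M B^q M')^s2)], where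
   [L = K Z], [M = Z^-1] and the prime denotes the adjoint.  Each term is concave,
   and [Z] is chosen to make this bound sharp, up to [e], at the convex
   combination. *)
Lemma concave_pq_shift e : 0 < p -> 0 < q -> 0 < e ->
  t * ext_dg N (fun i => c1 i `^ s) + (1 - t) * ext_dg N (fun i => c2 i `^ s) <=
  N (dg (fun i => c0 i `^ s + e)).
Proof.
move=> p_gt0 q_gt0 e_gt0.
have [t0 t1] : 0 <= t /\ 0 <= 1 - t by case/andP: t01; rewrite subr_ge0.
have pq_gt0 : 0 < p + q by rewrite addr_gt0.
(* Chosen so that [p s1 = q s2 = (p + q) s <= 1], the range of the one-variable theorem, while
   [1/s1 + 1/s2 = 1/s]. *)
pose s1 := s * (p + q) / p; pose s2 := s * (p + q) / q.
have s1_gt0 : 0 < s1 by rewrite /s1 divr_gt0 ?mulr_gt0.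
have s2_gt0 : 0 < s2 by rewrite /s2 divr_gt0 ?mulr_gt0.
have sE : s^-1 = s1^-1 + s2^-1.
  by rewrite /s1 /s2; field; rewrite !gt_eqF.
have ps1 : p * s1 <= 1 by rewrite /s1 mulrC divfK ?gt_eqF // mulrC.
have qs2 : q * s2 <= 1 by rewrite /s2 mulrC divfK ?gt_eqF // mulrC.
have c0_ge0 := gram_eig_ge0 W0u H0.
(* The shift by [e] makes [w] positive, so that its negative powers are available even if the
   functional's matrix is singular. *)
pose w i := c0 i `^ s + e.
have w_gt0 i : 0 < w i by rewrite ltr_wpDl ?powR_ge0.
have w_ge0 i : 0 <= w i := ltW (w_gt0 i).
have w_nd : nondecr w.
  move=> i j ij; rewrite lerD2r; apply: (ge0_ler_powR (ltW s_gt0)).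
  - exact: c0_ge0.
  - exact: c0_ge0.
  - exact: c0_nd.
have c0w i : c0 i <= w i `^ s^-1.
  rewrite -[leLHS](powRr1 (c0_ge0 i)) -(mulfV (lt0r_neq0 s_gt0)) powRrM.
  apply: ge0_ler_powR; rewrite ?nnegrE ?invr_ge0 ?(ltW s_gt0) ?powR_ge0 //.
  by rewrite /w lerDl ltW.
(* With [Z = B^(q/2) D] at index [0], the term in [B] becomes exactly [w^(1/s2)], and the term in
   [A] becomes [D (spec W0 c0) D <= w^(1/s - 1/s2) = w^(1/s1)]. After the powers [s2] and [s1], both
   anti-norms are at most [N (dg w)]. *)
pose D := spec W0 (fun i => w i `^ (- (s2^-1 / 2))).
pose Di := spec W0 (fun i => w i `^ (s2^-1 / 2)).
pose Y := spec V0 (fun i => b0 i `^ (q / 2)).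
pose Yi := spec V0 (fun i => b0 i `^ (- (q / 2))).
have DDi : D *m Di = 1%:M.
  rewrite (specM _ _ W0u) -[RHS](spec_const 1 W0u); apply: eq_spec => i.
  by rewrite powRN mulVf // gt_eqF // powR_gt0.
have YYi : Y *m Yi = 1%:M.
  rewrite (specM _ _ V0u) -[RHS](spec_const 1 V0u); apply: eq_spec => i.
  by rewrite powRN mulfV // gt_eqF // powR_gt0.
pose Z := Y *m D; pose Zi := Di *m Yi.
have ZZi : Z *m Zi = 1%:M by rewrite /Z /Zi mulmxA -(mulmxA Y) DDi mulmx1.
have Ziu : Zi \in unitmx := (mulmx1_unit ZZi).2.
have bound U V W a b c : unitary U -> unitary V -> unitary W -> nondecr c ->
    (forall i, 0 < a i) -> (forall i, 0 < b i) ->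
    adj (factor U V a b) *m factor U V a b = spec W c ->
    exists G x H y, [/\ unitary G, nondecr x,
      adj (K *m Z) *m spec U (fun i => a i `^ p) *m (K *m Z) = spec G x &
      [/\ unitary H, nondecr y,
       adj (adj Zi) *m spec V (fun i => b i `^ q) *m adj Zi = spec H y &
       ext_dg N (fun i => c i `^ s) <= s / s1 * ext_dg N (fun i => x i `^ s1) +
         s / s2 * ext_dg N (fun i => y i `^ s2)]].
  move=> Uu Vu Wu nc a_gt0 b_gt0 E.
  have [G [x [Gu nx GE]]] := spectral_sorted (herm_conj U (fun i => a i `^ p) (K *m Z)).
  have [H [y [Hu ny HE]]] := spectral_sorted (herm_conj V (fun i => b i `^ q) (adj Zi)).
  exists G, x, H, y; split => //; split => //.
  pose S := spec U (fun i => a i `^ (p / 2)) *m K *m Z.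
  pose T := Zi *m spec V (fun i => b i `^ (q / 2)).
  have ST : S *m T = factor U V a b.
    by rewrite /S /T mulmxA -(mulmxA _ Z) ZZi mulmx1.
  apply: (hoelder_ext HN HH (S := S) (T := T) (U := G) (V := H) (W := W)
    s_gt0 s1_gt0 s2_gt0 sE _ Gu Hu Wu nc).
  - rewrite /T unitmx_mul Ziu; apply: spec_unitmx => // i; exact: powR_gt0.
  - by rewrite -GE /S -(mulmxA _ K) (gram_spec_mul (K *m Z) p Uu a_gt0).
  - by rewrite -HE adjK /T (gram_mul_spec Zi q Vu b_gt0).
  - by rewrite ST.
have [G1 [x1 [F1 [y1 [G1u x1_nd G1E [F1u y1_nd F1E le1]]]]]] :=
  bound _ _ _ _ _ _ U1u V1u W1u c1_nd a1_gt0 b1_gt0 H1.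
have [G2 [x2 [F2 [y2 [G2u x2_nd G2E [F2u y2_nd F2E le2]]]]]] :=
  bound _ _ _ _ _ _ U2u V2u W2u c2_nd a2_gt0 b2_gt0 H2.
have [G0 [x0 [G0u x0_nd G0E]]] :=
  spectral_sorted (herm_conj U0 (fun i => a0 i `^ p) (K *m Z)).
pose y0 i := w i `^ s2^-1.
have y0_nd : nondecr y0.
  move=> i j ij; apply: ge0_ler_powR; rewrite ?nnegrE ?invr_ge0 ?(ltW s2_gt0) ?w_ge0 //.
  exact: w_nd.
have F0E : adj (adj Zi) *m spec V0 (fun i => b0 i `^ q) *m adj Zi = spec W0 y0.
  rewrite adjK -(spec_half_sq _ V0u b0_gt0) -/Y mulmxA -(mulmxA _ Y).
  have ZiY : Zi *m Y = Di by rewrite /Zi -mulmxA (mulmx1C YYi) mulmx1.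
  have YZi : Y *m adj Zi = Di.
    by rewrite -[RHS]spec_adj -[X in _ = adj X]/Di -ZiY (adjM Zi) spec_adj.
  by rewrite ZiY YZi (spec_half_sq _ W0u w_gt0).
have x0w i : x0 i <= w i `^ s1^-1.
  have v_nd : nondecr (fun i => w i `^ s1^-1).
    move=> k j kj; apply: ge0_ler_powR; rewrite ?nnegrE ?invr_ge0 ?(ltW s1_gt0) ?w_ge0 //.
    exact: w_nd.
  apply: (weyl_mono G0u W0u x0_nd v_nd) => v.
  have -> : spec G0 x0 = D *m spec W0 c0 *m D.
    rewrite -G0E -H0 /factor -/Y -(spec_half_sq _ U0u a0_gt0) /Z.
    rewrite (adjM K) (adjM Y) (adjM _ Y) (adjM _ K) !spec_adj.
    by rewrite !mulmxA.
  rewrite (specM _ _ W0u) (specM _ _ W0u).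
  apply: ler_tf_spec_pointwise => j.
  have -> : w j `^ s1^-1 = 
      w j `^ (- (s2^-1 / 2)) * w j `^ s^-1 * w j `^ (- (s2^-1 / 2)).
    rewrite -!powRD ?(gt_eqF (w_gt0 j)) ?implybT //; congr (_ `^ _).
    by rewrite sE; field; rewrite !gt_eqF.
  by rewrite ler_wpM2r ?powR_ge0 // ler_wpM2l ?powR_ge0.
have X := one_variable_concave HN U0u U1u U2u G0u G1u G2u a0_ge0 a1_ge0 a2_ge0
  x0_nd x1_nd x2_nd t01 HA G0E G1E G2E p01 s1_gt0 ps1.
have Y' := one_variable_concave HN V0u V1u V2u W0u F1u F2u b0_ge0 b1_ge0 b2_ge0
  y0_nd y1_nd y2_nd t01 HB F0E F1E F2E q01 s2_gt0 qs2.
have ww (r : R) i : 0 < r -> (w i `^ r^-1) `^ r = w i.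
  by move=> r0; rewrite -powRrM mulVf ?gt_eqF // powRr1.
have xw : ext_dg N (fun i => x0 i `^ s1) <= N (dg w).
  rewrite -(ext_dg_pos HN w_gt0); apply: ext_dg_mono => // i; first exact: powR_ge0.
  have ap j : 0 <= a0 j `^ p by exact: powR_ge0.
  rewrite -[leRHS](ww s1) //; apply: (ge0_ler_powR (ltW s1_gt0)).
  - exact: (conj_eig_ge0 G0u ap G0E).
  - exact: powR_ge0.
  - exact: x0w.
have yw : ext_dg N (fun i => y0 i `^ s2) = N (dg w).
  rewrite -(ext_dg_pos HN w_gt0); congr ext_dg; apply/funext => i.
  exact: ww.
have ss1_gt0 : 0 < s / s1 by rewrite divr_gt0.
have ss2_gt0 : 0 < s / s2 by rewrite divr_gt0.
have ss : s / s1 + s / s2 = 1 by rewrite -mulrDr -sE mulfV ?gt_eqF.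
rewrite yw in Y'.
exact: (weighted_bound t0 t1 (ltW ss1_gt0) (ltW ss2_gt0) ss le1 le2 (le_trans X xw) Y').
Qed.

Lemma triple_concave : goal.
Proof.
have [p0|pn0] := eqVneq p 0; first exact: concave_p0.
have [q0|qn0] := eqVneq q 0; first exact: concave_q0.
have p_gt0 : 0 < p by case/andP: p01; rewrite lt0r pn0.
have q_gt0 : 0 < q by case/andP: q01; rewrite lt0r qn0.
apply: limr_ge; first by apply: (ext_dg_cvg HN) => i; exact: powR_ge0.
by near=> e; exact: concave_pq_shift.
Unshelve. all: by end_near. Qed.

End Triple.
End JointConcavity.

(** * Passage from the matrix functional to spectral data *)

Lemma antinorm_functional (R : realType) (n : nat) (K : 'M[R[i]]_n)
    (N : 'M[R[i]]_n -> R) (p q s : R) (A B : 'M[R[i]]_n) :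
  symmetric_antinorm N -> posdef A -> posdef B ->
  exists U a V b W c,
  [/\ unitary U /\ unitary V, (forall i, 0 < a i) /\ (forall i, 0 < b i),
    A = spec U a /\ B = spec V b, unitary W /\ nondecr c &
    adj (factor p q K U V a b) *m factor p q K U V a b = spec W c /\
    antinorm_ext N
      (mxpow (mxpow B (q / 2) *m K ^t* *m mxpow A p *m K *m mxpow B (q / 2)) s) =
    ext_dg N (fun i => c i `^ s)].
Proof.
move=> HN /posdefP[U [a [Uu na a0 AE]]] /posdefP[V [b [Vu nb b0 BE]]].
pose M := factor p q K U V a b.
have Mh : adj M *m M \is hermsymmx.
  by apply/is_hermitianmxP; rewrite expr0 scale1r -adjE (adjM (adj M)) adjK.
have [W [c [Wu nc ME]]] := spectral_sorted Mh.
exists U, a, V, b, W, c; split => //; split => //.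
rewrite AE BE !(mxpow_spec _ _ Uu) !(mxpow_spec _ _ Vu) -adjE.
have -> : spec V (fun i => b i `^ (q / 2)) *m adj K *m spec U (fun i => a i `^ p) *m K
    *m spec V (fun i => b i `^ (q / 2)) = spec W c.
  rewrite -ME /M /factor -(spec_half_sq _ Uu a0).
  rewrite (adjM (_ *m K)) (adjM _ K) !spec_adj.
  by rewrite !mulmxA.
rewrite (mxpow_spec _ _ Wu); apply: (antinorm_ext_spec HN Wu) => i.
exact: powR_ge0.
Qed.

Lemma antinorm_functional_concave (R : realType) (n : nat) (K : 'M[R[i]]_n)
    (N : 'M[R[i]]_n -> R) (p q s t : R) (A0 A1 A2 B0 B1 B2 : 'M[R[i]]_n) :
  let f (A B : 'M[R[i]]_n) := antinorm_ext N
    (mxpow (mxpow B (q / 2) *m K ^t* *m mxpow A p *m K *m mxpow B (q / 2)) s) in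
  symmetric_antinorm N -> antinorm_hoelder N ->
  0 <= p <= 1 -> 0 <= q <= 1 -> 0 < s -> (p + q) * s <= 1 -> 0 <= t <= 1 ->
  posdef A1 -> posdef A2 -> posdef B1 -> posdef B2 ->
  A0 = t%:C *: A1 + (1 - t)%:C *: A2 -> B0 = t%:C *: B1 + (1 - t)%:C *: B2 ->
  t * f A1 B1 + (1 - t) * f A2 B2 <= f A0 B0.
Proof.
move=> f HN HH p01 q01 s0 pqs t01 pA1 pA2 pB1 pB2 A0E B0E.
have pA0 : posdef A0 by rewrite A0E; exact: posdef_convex.
have pB0 : posdef B0 by rewrite B0E; exact: posdef_convex.
have [U1 [a1 [V1 [b1 [W1 [c1 [[U1u V1u] [a1p b1p] [A1S B1S] [W1u c1n] [E1 F1]]]]]]]] :=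
  antinorm_functional K p q s HN pA1 pB1.
have [U2 [a2 [V2 [b2 [W2 [c2 [[U2u V2u] [a2p b2p] [A2S B2S] [W2u c2n] [E2 F2]]]]]]]] :=
  antinorm_functional K p q s HN pA2 pB2.
have [U0 [a0 [V0 [b0 [W0 [c0 [[U0u V0u] [a0p b0p] [A0S B0S] [W0u c0n] [E0 F0]]]]]]]] :=
  antinorm_functional K p q s HN pA0 pB0.
have transfer (u0 u1 u2 v0 v1 v2 : R) : u1 = v1 -> u2 = v2 -> u0 = v0 ->
  t * v1 + (1 - t) * v2 <= v0 -> t * u1 + (1 - t) * u2 <= u0 by move=> -> -> ->.
apply: (transfer _ _ _ _ _ _ F1 F2 F0).
apply: (triple_concave HN HH U0u U1u U2u V0u V1u V2u W0u W1u W2u a0p a1p a2p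
  b0p b1p b2p c0n c1n c2n t01 _ _ E0 E1 E2 p01 q01 s0 pqs).
- by rewrite -A0S -A1S -A2S.
- by rewrite -B0S -B1S -B2S.
Qed.

Theorem theorem4p4 (R : realType) (n : nat) (K : 'M[R[i]]_n)
    (N : 'M[R[i]]_n -> R) (p q s : R) :
  (1 <= n)%N ->
  symmetric_antinorm N ->
  antinorm_hoelder N ->
  0 <= p <= 1 ->
  0 <= q <= 1 ->
  0 < s ->
  (p + q != 0 -> s <= 1 / (p + q)) ->
  jointly_concave posdef (fun A B : 'M[R[i]]_n =>
    antinorm_ext N
      (mxpow (mxpow B (q / 2) *m K ^t* *m mxpow A p *m K *m mxpow B (q / 2)) s)).
Proof.
move=> _ HN HH p01 q01 s0 pqs A1 A2 B1 B2 pA1 pA2 pB1 pB2 t t01.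
(* The product form of the bound on [s] also covers [p = q = 0], where it holds trivially. *)
have pqs1 : (p + q) * s <= 1.
  have [->|pq0] := eqVneq (p + q) 0; first by rewrite mul0r.
  have pq : 0 < p + q.
    by rewrite lt0r pq0 addr_ge0 //; [case/andP: p01|case/andP: q01].
  by have := pqs pq0; rewrite ler_pdivlMr // mulrC.
exact: (antinorm_functional_concave K HN HH p01 q01 s0 pqs1 t01 pA1 pA2 pB1 pB2).
Qed.
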